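(* Let $\{x_{ij};\, i,j\ge 1\}$ be i.i.d. real random variables with mean $\mu$ and variance $\sigma^2>0$, and assume $|x_{11}|\le C$ for a finite constant $C>0$. Let $p=p(n)$ be positive integers with $p\to\infty$ and $\log p=o(n)$ as $n\to\infty$. Let $X_n=(x_{ij})_{1\le i\le n,\,1\le j\le p}$ and let $L_n$ be the coherence of $X_n$, i.e. the largest absolute value of the off-diagonal entries of its sample correlation matrix. Then $$\sqrt{\frac{n}{\log p}}\;L_n\to 2\quad\text{in probability as } n\to\infty .$$
   Context: Let $x_1,\dots,x_p\in\mathbb{R}^n$ be the columns of $X_n$, $\bar x_k=\frac1n\sum_{i=1}^n x_{ik}$, and $e=(1,\dots,1)^T\in\mathbb{R}^n$; write $x_i-\bar x_i$ for $x_i-\bar x_i e$. With $\|\cdot\|$ the Euclidean norm, the sample correlation coefficients are $$\rho_{ij}=\frac{(x_i-\bar x_i)^T(x_j-\bar x_j)}{\|x_i-\bar x_i\|\cdot\|x_j-\bar x_j\|},\quad 1\le i,j\le p,$$ and $L_n=\max_{1\le i<j\le p}|\rho_{ij}|$. $\log$ is the natural logarithm. *)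

(* Defs.v *)
From HB Require Import structures.
From mathcomp Require Import all_boot all_order all_algebra finmap.
From mathcomp Require Import all_classical all_reals all_analysis.
Set Implicit Arguments.
Unset Strict Implicit.
Unset Printing Implicit Defensive.
Import Order.TTheory GRing.Theory Num.Theory.
Import numFieldNormedType.Exports.
Local Open Scope classical_set_scope.
Local Open Scope ring_scope.

Definition mutually_independent d (T : measurableType d) (R : realType)
    (P : probability T R) (I : choiceType) (X : I -> {RV P >-> R}) : Prop :=
  forall (J : {fset I}) (A : I -> set R),
    (forall k, k \in J -> measurable (A k)) ->
    P (\bigcap_(k in [set` J]) (X k @^-1` A k)) =
    (\prod_(k <- J) P (X k @^-1` A k))%E.

(* The two laws are only compared on Borel sets: as Rocq functions,
   [distribution P X] and [distribution P Y] also take (meaningless) values on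
   non-measurable sets. *)
Definition identically_distributed d (T : measurableType d) (R : realType)
    (P : probability T R) (X Y : {RV P >-> R}) : Prop :=
  forall A : set R, measurable A -> distribution P X A = distribution P Y A.

Definition iid d (T : measurableType d) (R : realType)
    (P : probability T R) (I : choiceType) (X : I -> {RV P >-> R}) : Prop :=
  mutually_independent X /\ forall k l, identically_distributed (X k) (X l).

Definition cvg_in_probability d (T : measurableType d) (R : realType)
    (P : probability T R) (Y : nat -> T -> R) (l : R) : Prop :=
  forall eps : R, 0 < eps ->
    P [set w | eps <= `|Y n w - l|] @[n --> \oo] --> 0%E.

Section coherence.
Context {R : realType}.

Definition sample_mean n (u : 'cV[R]_n) : R := (\sum_(i < n) u i 0) / n%:R.

Definition centered n (u : 'cV[R]_n) : 'cV[R]_n := u - const_mx (sample_mean u).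

(* MathComp-Analysis's own norm on matrices is the sup norm. *)
Definition euclidean_norm n (u : 'cV[R]_n) : R :=
  Num.sqrt (\sum_(i < n) u i 0 ^+ 2).

(* As [x / 0 = 0], the coefficient is 0 when one of the columns is constant. *)
Definition sample_correlation n p (X : 'M[R]_(n, p)) : 'M[R]_p :=
  \matrix_(i < p, j < p)
    (((centered (col i X))^T *m centered (col j X)) 0 0 /
     (euclidean_norm (centered (col i X)) * euclidean_norm (centered (col j X)))).

(* The default value 0 of the maximum only matters when [p < 2]. *)
Definition coherence n p (X : 'M[R]_(n, p)) : R :=
  \big[Num.max/0]_(k : 'I_p * 'I_p | (k.1 < k.2)%N)
    `|sample_correlation X k.1 k.2|.

End coherence.

(* Main.v *)
(* The correlations are invariant under affine changes of the data, so the entries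
   may be taken bounded, of mean 0 and variance 1. Put L = ln p and s = sqrt (L/n),
   so that s tends to 0 and n s^2 = L. Every sum over the n rows of independent
   centered bounded terms of variance v has an exponential moment
   exp (n (t^2 v/2 + O(t^3))), which at t of order s is p to a power, up to
   negligible factors. Chernoff bounds and a union bound show that all column sums
   and squared column norms deviate by O(n s) only, and that all scalar products of
   distinct columns are at most (2 + eps) n s. A matching lower bound for the tail
   of one scalar product also comes from exponential moments alone: on
   {S < A} or {S > A'} the weight exp (t S) is dominated by a weight with a smaller
   or larger t. It feeds a second moment argument over pairs (i, m + j) with
   i, j < m = p/2: disjoint pairs are independent, and for two pairs sharing a
   column the sum of the two scalar products, whose terms have variance 2, satisfies
   a Chernoff bound close to the square of the tail of one of them. *)
Require Import Defs.
From HB Require Import structures.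
From mathcomp Require Import all_boot all_order all_algebra finmap.
From mathcomp Require Import all_classical all_reals all_analysis.
From mathcomp Require Import measurable_realfun zify ring lra.
Set Implicit Arguments.
Unset Strict Implicit.
Unset Printing Implicit Defensive.
Import Order.TTheory GRing.Theory Num.Theory.
Import numFieldNormedType.Exports.
Local Open Scope classical_set_scope.
Local Open Scope ring_scope.

(** * Independence of functions of disjoint families of variables *)

Section bounded_measurable.
Context d (T : measurableType d) (R : realType).
Implicit Types f g : T -> R.

(** All means below are taken of functions in this class. It is closed under the operations needed
    and integrable under any probability, so linearity and monotonicity of the mean carry no further
    integrability conditions. *)
Definition bounded_measurable f :=
  measurable_fun setT f /\ exists M, forall w, `|f w| <= M.

Lemma bounded_measurable_cst (r : R) : bounded_measurable (fun=> r).
Proof. by split; [exact: measurable_cst | exists `|r|]. Qed.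

Lemma bounded_measurableD f g : bounded_measurable f -> bounded_measurable g ->
  bounded_measurable (fun w => f w + g w).
Proof.
move=> [mf [M fM]] [mg [N gN]]; split; first exact: measurable_funD.
by exists (M + N) => w; rewrite (le_trans (ler_normD _ _))// lerD.
Qed.

Lemma bounded_measurableM f g : bounded_measurable f -> bounded_measurable g ->
  bounded_measurable (fun w => f w * g w).
Proof.
move=> [mf [M fM]] [mg [N gN]]; split; first exact: measurable_funM.
by exists (M * N) => w; rewrite normrM ler_pM.
Qed.

Lemma bounded_measurableZ (r : R) f : bounded_measurable f ->
  bounded_measurable (fun w => r * f w).
Proof. exact/bounded_measurableM/bounded_measurable_cst. Qed.

Lemma bounded_measurableN f : bounded_measurable f ->
  bounded_measurable (fun w => - f w).
Proof.
move=> /(bounded_measurableZ (-1)); congr bounded_measurable.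
by apply/funext => w; rewrite mulN1r.
Qed.

Lemma bounded_measurableB f g : bounded_measurable f -> bounded_measurable g ->
  bounded_measurable (fun w => f w - g w).
Proof. by move=> bf /bounded_measurableN; exact: bounded_measurableD. Qed.

Lemma bounded_measurableX f n : bounded_measurable f ->
  bounded_measurable (fun w => f w ^+ n).
Proof.
move=> bf; elim: n => [|n IHn]; first exact: bounded_measurable_cst.
by under eq_fun do rewrite exprS; exact: bounded_measurableM.
Qed.

Lemma bounded_measurable_sum (I : Type) (s : seq I) (F : I -> T -> R) :
  (forall i, bounded_measurable (F i)) ->
  bounded_measurable (fun w => \sum_(i <- s) F i w).
Proof.
move=> bF; elim: s => [|i s IHs].
  by under eq_fun do rewrite big_nil; exact: bounded_measurable_cst.
by under eq_fun do rewrite big_cons; exact: bounded_measurableD.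
Qed.

Lemma bounded_measurable_expR f : bounded_measurable f ->
  bounded_measurable (fun w => expR (f w)).
Proof.
move=> [mf [M fM]]; split; first exact: measurableT_comp.
exists (expR M) => w; rewrite ger0_norm ?expR_ge0// ler_expR.
exact: le_trans (ler_norm _) (fM w).
Qed.

Lemma bounded_measurable_indic (A : set T) : measurable A ->
  bounded_measurable (\1_A : T -> R).
Proof.
move=> mA; split; first exact: measurable_indic.
by exists 1 => w; rewrite indicE; case: (_ \in _); rewrite ?normr0 ?normr1.
Qed.

Lemma measurable_ge f (t : R) : bounded_measurable f ->
  measurable [set w | t <= f w].
Proof.
by move=> [mf _]; rewrite -[X in measurable X]setTI; exact: measurable_fun_le.
Qed.

End bounded_measurable.

(** * Means of bounded measurable functions *)

Section expectation.
Context d (T : measurableType d) (R : realType) (P : probability T R).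
Implicit Types f g : T -> R.

Definition mean f : R := Rintegral P setT f.

Lemma bounded_measurable_integrable f : bounded_measurable f ->
  P.-integrable setT (EFin \o f).
Proof.
move=> [mf [M fM]]; apply: measurable_bounded_integrable => //.
  by rewrite (le_lt_trans (probability_le1 _ _))// ltry.
by exists M; split; [exact: num_real | move=> x Mx w _ /=; exact: le_trans (fM w) (ltW Mx)].
Qed.

Lemma eq_mean f g : f =1 g -> mean f = mean g.
Proof. by move=> fg; apply: eq_Rintegral => w _. Qed.

Lemma mean_cst (r : R) : mean (fun=> r) = r.
Proof.
have := @probability_setT _ _ _ P; rewrite /mean Rintegral_cst// => PT.
by rewrite -[RHS]mulr1; congr (_ * _); rewrite -[RHS]/(fine (1%:E)) -PT.
Qed.

Lemma meanD f g : bounded_measurable f -> bounded_measurable g ->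
  mean (fun w => f w + g w) = mean f + mean g.
Proof.
by move=> bf bg; rewrite /mean RintegralD//; exact: bounded_measurable_integrable.
Qed.

Lemma meanZ (r : R) f : bounded_measurable f ->
  mean (fun w => r * f w) = r * mean f.
Proof.
by move=> bf; rewrite /mean RintegralZl//; exact: bounded_measurable_integrable.
Qed.

Lemma meanB f g : bounded_measurable f -> bounded_measurable g ->
  mean (fun w => f w - g w) = mean f - mean g.
Proof.
by move=> bf bg; rewrite /mean RintegralB//; exact: bounded_measurable_integrable.
Qed.

Lemma mean_sum (I : Type) (s : seq I) (F : I -> T -> R) :
  (forall i, bounded_measurable (F i)) ->
  mean (fun w => \sum_(i <- s) F i w) = \sum_(i <- s) mean (F i).
Proof.
move=> bF; elim: s => [|i s IHs].
  by rewrite big_nil -[RHS]mean_cst; apply: eq_mean => w; rewrite big_nil.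
rewrite big_cons -IHs -meanD//; last exact: bounded_measurable_sum.
by apply: eq_mean => w; rewrite big_cons.
Qed.

Lemma le_mean f g : bounded_measurable f -> bounded_measurable g ->
  (forall w, f w <= g w) -> mean f <= mean g.
Proof.
move=> bf bg fg; rewrite /mean le_Rintegral//; exact: bounded_measurable_integrable.
Qed.

Lemma mean_indic (A : set T) : measurable A -> mean \1_A = fine (P A).
Proof. by move=> mA; rewrite /mean /Rintegral integral_indic// setIT. Qed.

End expectation.

Section independence.
Context d (T : measurableType d) (R : realType) (P : probability T R).
Context (K : choiceType) (X : K -> T -> R).

(** Finite-dimensional cylinders: a pi-system generating the sigma-algebra of the variables [X k]
    with [k] in [I]. *)
Definition cylinders (I : set K) : set (set T) :=
  [set A | exists (F : {fset K}) (B : K -> set R),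
    (forall k, k \in F -> I k /\ measurable (B k)) /\
    A = \bigcap_(k in [set` F]) (X k @^-1` B k)].

(** Measurability for the generated sigma-algebra is expressed by changing the measurable structure
    of [T], so that the closure lemmas on [bounded_measurable] apply unchanged. *)
Definition depends_on (I : set K) (f : T -> R) :=
  @bounded_measurable _ (g_sigma_algebraType (cylinders I)) R f.

Hypothesis mX : forall k, measurable_fun setT (X k).
Hypothesis indep : forall (F : {fset K}) (B : K -> set R),
  (forall k, k \in F -> measurable (B k)) ->
  P (\bigcap_(k in [set` F]) (X k @^-1` B k)) =
  (\prod_(k <- F) P (X k @^-1` B k))%E.

Lemma cylinders_setI_closed I : setI_closed (cylinders I).
Proof.
move=> _ _ [F [B [FB ->]]] [G [C [GC ->]]].
exists (F `|` G)%fset.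
exists (fun k => (if k \in F then B k else setT) `&`
                 (if k \in G then C k else setT)); split.
  move=> k; rewrite inE => /orP kFG; split.
    by case: kFG => [/FB[]|/GC[]].
  apply: measurableI.
    by case: ifPn => [/FB[]|].
  by case: ifPn => [/GC[]|].
apply/seteqP; split => [w [wF wG] k /= _|w wFG].
  by split; case: ifPn => // kFG; [exact: wF | exact: wG].
split=> k kF.
  have : k \in (F `|` G)%fset by rewrite inE kF.
  by move=> /wFG []; rewrite kF.
have : k \in (F `|` G)%fset by rewrite inE kF orbT.
by move=> /wFG []; rewrite kF.
Qed.

Lemma cylinders_measurable I A : cylinders I A -> measurable A.
Proof.
move=> [F [B [FB ->]]]; apply: fin_bigcap_measurable => // k kF.
rewrite -[X in measurable X]setTI; apply: mX => //.
by have [] := FB _ kF.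
Qed.

Lemma g_cylinders_measurable I A : <<s cylinders I>> A -> measurable A.
Proof.
apply: smallest_sub; last exact: cylinders_measurable.
exact: sigma_algebra_measurable.
Qed.

Lemma depends_on_measurable I f : depends_on I f -> bounded_measurable f.
Proof.
move=> [mf bf]; split => // _ A mA; rewrite setTI.
apply: (@g_cylinders_measurable I); rewrite -[X in smallest _ _ X]setTI.
exact: mf.
Qed.

Lemma depends_onS I J f : I `<=` J -> depends_on I f -> depends_on J f.
Proof.
move=> IJ [mf bf]; split => // _ A mA; have /= := mf measurableT A mA.
apply: sub_smallest2r; first exact: smallest_sigma_algebra.
move=> _ [F [B [FB ->]]]; exists F, B; split => // k /FB[Ik mB].
by split => //; exact: IJ.
Qed.

Lemma depends_on_coord k : (exists M, forall w, `|X k w| <= M) ->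
  depends_on [set k] (X k).
Proof.
move=> bX; split => // _ A mA; rewrite setTI.
apply: sub_gen_smallest; exists [fset k]%fset, (fun=> A); split.
  by move=> l; rewrite inE => /eqP ->.
apply/seteqP; split => [w Aw l /=|w /(_ k)/=].
  by rewrite inE => /eqP ->.
by rewrite inE eqxx => /(_ isT).
Qed.

(** With disjoint supports the two cylinders glue into a single one over the union of the supports,
    to which [indep] applies; the product over the union then splits. *)
Lemma disjoint_cylinders I J A B : I `&` J = set0 ->
  cylinders I A -> cylinders J B -> P (A `&` B) = (P A * P B)%E.
Proof.
move=> IJ [F [A' [FA ->]]] [G [B' [GB ->]]].
have FG k : k \in F -> k \in G = false.
  move=> kF; apply/negbTE/negP => kG.
  have : (I `&` J) k by split; [have [] := FA _ kF | have [] := GB _ kG].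
  by rewrite IJ.
pose C k := if k \in F then A' k else B' k.
have -> : \bigcap_(k in [set` F]) (X k @^-1` A' k) =
    \bigcap_(k in [set` F]) (X k @^-1` C k).
  by apply: eq_bigcapr => k kF; rewrite /C kF.
have -> : \bigcap_(k in [set` G]) (X k @^-1` B' k) =
    \bigcap_(k in [set` G]) (X k @^-1` C k).
  apply: eq_bigcapr => k /= kG; rewrite /C ifN//.
  by apply/negP => /FG; rewrite kG.
have mC k : k \in F \/ k \in G -> measurable (C k).
  by rewrite /C; case: ifPn => [kF _|_ [//|kG]]; [have [] := FA _ kF | have [] := GB _ kG].
have -> : \bigcap_(k in [set` F]) (X k @^-1` C k) `&`
    \bigcap_(k in [set` G]) (X k @^-1` C k) =
    \bigcap_(k in [set` (F `|` G)%fset]) (X k @^-1` C k).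
  apply/seteqP; split => [w [wF wG] k /=|w wFG].
    by rewrite inE => /orP[/wF|/wG].
  by split=> k kF; apply: wFG; rewrite /= inE kF ?orbT.
rewrite !indep; [|by move=> k kG; apply: mC; right|by move=> k kF; apply: mC; left|].
  rewrite (perm_big (enum_fset F ++ enum_fset G)) ?big_cat//=.
  apply: uniq_perm => //.
    rewrite cat_uniq !fset_uniq andbT/=.
    by apply/hasPn => k kG; apply/negP => /FG; rewrite kG.
  by move=> k; rewrite mem_cat inE.
by move=> k; rewrite inE => /orP kFG; exact: mC.
Qed.

(** Dynkin's pi-lambda argument: for fixed [B], the events [A] satisfying the identity are stable
    under complements and disjoint countable unions, and they include a generating pi-system. *)
Lemma setI_sigma_indep I (B : set T) : measurable B ->
  (forall A, cylinders I A -> P (A `&` B) = (P A * P B)%E) ->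
  forall A, <<s cylinders I>> A -> P (A `&` B) = (P A * P B)%E.
Proof.
move=> mB IB A.
have fP (C : set T) : measurable C -> P C \is a fin_num by move=> mC; exact: fin_num_measure.
have gm (C : set T) := @g_cylinders_measurable I C.
have QT : P (setT `&` B) = (P setT * P B)%E.
  by rewrite setTI probability_setT mul1e.
have QC (S : set T) : measurable S -> P (S `&` B) = (P S * P B)%E ->
    P (~` S `&` B) = (P (~` S) * P B)%E.
  move=> mS PS; rewrite setIC -setDE measureD//; last first.
    by rewrite (le_lt_trans (probability_le1 _ _))// ltry.
  transitivity (P B - P S * P B)%E.
    by congr (_ - _)%E; rewrite setIC; exact: PS.
  rewrite probability_setC// muleBl ?mul1e//.
  exact: fP.
have QU (F : (set T)^nat) : (forall n, measurable (F n)) ->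
    trivIset setT F -> (forall n, P (F n `&` B) = (P (F n) * P B)%E) ->
    P (\bigcup_k F k `&` B) = (P (\bigcup_k F k) * P B)%E.
  move=> mF tF PF; rewrite setI_bigcupl.
  have mFB n : measurable (F n `&` B) by exact: measurableI.
  rewrite !measure_bigcup//; last exact: trivIset_setIr.
  rewrite muleC -[X in (X * _)%E](fineK (fP _ mB)) -nneseriesZl//.
  by apply: eq_eseriesr => n _; rewrite fineK ?fP// muleC; exact: PF.
apply: (@dynkin_induction _ (g_sigma_algebraType (cylinders I)) (cylinders I)
  (fun A => P (A `&` B) = (P A * P B)%E)) => //.
- exact: cylinders_setI_closed.
- by move=> S /gm mS; exact: QC.
- by move=> F mF tF; apply: QU => // n; apply: gm; exact: mF.
Qed.

(** The Dynkin extension is used twice, passing from cylinders to the generated sigma-algebra in one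
    factor at a time. *)
Lemma sigma_indep I J A B : I `&` J = set0 ->
  <<s cylinders I>> A -> <<s cylinders J>> B -> P (A `&` B) = (P A * P B)%E.
Proof.
move=> IJ sA sB; apply: (setI_sigma_indep (I := I)) => //.
  exact: g_cylinders_measurable sB.
move=> C IC; rewrite setIC muleC; apply: (setI_sigma_indep (I := J)) => //.
  exact: cylinders_measurable IC.
by move=> D JD; rewrite setIC muleC; exact: (disjoint_cylinders IJ).
Qed.

(** The law of [(f, g)] agrees with the product of the two laws on rectangles by [sigma_indep],
    hence everywhere; Tonelli's theorem then separates the integral. *)
Lemma ge0_integral_prod I J f g : I `&` J = set0 ->
  depends_on I f -> depends_on J g ->
  (forall w, 0 <= f w) -> (forall w, 0 <= g w) ->
  (\int[P]_w (f w * g w)%:E = (\int[P]_w (f w)%:E) * (\int[P]_w (g w)%:E))%E.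
Proof.
move=> IJ df dg f0 g0.
have [mf _] := depends_on_measurable df.
have [mg _] := depends_on_measurable dg.
pose f' : {mfun T >-> R} := HB.pack f (isMeasurableFun.Build _ _ _ _ f mf).
pose g' : {mfun T >-> R} := HB.pack g (isMeasurableFun.Build _ _ _ _ g mg).
have mh : measurable_fun setT (fun w => (f w, g w)) by apply/measurable_fun_pairP; split.
pose h' : {mfun T >-> (R * R)%type} :=
  HB.pack (fun w => (f w, g w)) (isMeasurableFun.Build _ _ _ _ _ mh).
have PE A : measurable A ->
    (distribution P f' \x distribution P g')%E A = distribution P h' A.
  apply: product_measure_unique => B C mB mC.
  have sB : <<s cylinders I>> (f @^-1` B).
    by have [mf' _] := df; have := mf' measurableT B mB; rewrite setTI.
  have sC : <<s cylinders J>> (g @^-1` C).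
    by have [mg' _] := dg; have := mg' measurableT C mC; rewrite setTI.
  exact: (sigma_indep IJ sB sC).
(* Absolute values make the integrands nonnegative on the whole line; they disappear again because
   [f] and [g] are nonnegative. *)
have mabs : measurable_fun setT (fun x : R => `|x|%:E).
  by apply/measurable_EFinP; exact: measurable_realfun.normr_measurable.
have mF : measurable_fun setT (fun z : R * R => (`|z.1| * `|z.2|)%:E).
  apply/measurable_EFinP; apply: measurable_funM;
    apply: measurableT_comp => //; exact: measurableT_comp.
transitivity (\int[distribution P h']_z (`|z.1| * `|z.2|)%:E)%E.
  rewrite ge0_integral_distribution//.
  by apply: eq_integral => w _ /=; rewrite !ger0_norm.
rewrite -(eq_measure_integral _ (fun A mA _ => PE A mA)).
rewrite fubini_tonelli1//.
have absE (k : {mfun T >-> R}) : (forall w, 0 <= k w) ->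
    (\int[distribution P k]_y `|y|%:E = \int[P]_w (k w)%:E)%E.
  move=> k0; rewrite ge0_integral_distribution//.
  by apply: eq_integral => w _ /=; rewrite ger0_norm.
rewrite /fubini_F -(absE f')// -(absE g')//.
transitivity (\int[distribution P f']_x
    (`|x|%:E * \int[distribution P g']_y `|y|%:E))%E.
  by apply: eq_integral => x _; rewrite -ge0_integralZl.
by rewrite ge0_integralZr// integral_ge0.
Qed.

(** Adding the bounds [M] and [N] makes both factors nonnegative, which reduces to
    [ge0_integral_prod]; after expansion by linearity the shifts cancel. *)
Lemma mean_prod I J f g : I `&` J = set0 ->
  depends_on I f -> depends_on J g ->
  mean P (fun w => f w * g w) = mean P f * mean P g.
Proof.
move=> IJ df dg.
have [_ [M fM]] := df; have [_ [N gN]] := dg.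
have bf := depends_on_measurable df; have bg := depends_on_measurable dg.
have dfM : depends_on I (fun w => f w + M).
  by apply: bounded_measurableD => //; exact: bounded_measurable_cst.
have dgN : depends_on J (fun w => g w + N).
  by apply: bounded_measurableD => //; exact: bounded_measurable_cst.
have : mean P (fun w => (f w + M) * (g w + N)) =
    mean P (fun w => f w + M) * mean P (fun w => g w + N).
  rewrite /mean /Rintegral (ge0_integral_prod IJ)//.
  - have ifM := bounded_measurable_integrable P (depends_on_measurable dfM).
    have igN := bounded_measurable_integrable P (depends_on_measurable dgN).
    by rewrite fineM//; [exact: (integrable_fin_num _ ifM)
                        |exact: (integrable_fin_num _ igN)].
  - by move=> w; have := fM w; rewrite ler_norml; lra.
  - by move=> w; have := gN w; rewrite ler_norml; lra.
have -> : mean P (fun w => (f w + M) * (g w + N)) =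
    mean P (fun w => f w * g w + ((N * f w + M * g w) + M * N)).
  by apply: eq_mean => w; ring.
have bc := @bounded_measurable_cst _ T R.
have bfg := bounded_measurableM bf bg.
have bNf := bounded_measurableZ N bf; have bMg := bounded_measurableZ M bg.
have bNM := bounded_measurableD bNf bMg.
rewrite !meanD//; last exact: bounded_measurableD.
by rewrite !meanZ// !mean_cst; lra.
Qed.

End independence.

(** * Taylor bounds for the exponential *)

Section exponential.
Context (R : realType).

(** Used three times in a row on Taylor remainders of the exponential: the derivative of each
    remainder is the preceding one, so the constant 2 persists while the power of [|u|] grows by
    one. *)
Lemma mean_value_bound (f df : R -> R) (M u : R) :
  (forall x : R, is_derive x 1 f (df x)) ->
  (forall x, `|x| <= `|u| -> `|df x| <= M) ->
  `|f u - f 0| <= M * `|u|.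
Proof.
move=> fdf dfM.
have cf a b : {within `[a, b], continuous f}.
  by apply: derivable_within_continuous => x _; have [] := fdf x.
have [u0|u0] := leP 0 u.
  have [c c0u ->] := MVT_segment u0 (fun x _ => fdf x) (cf _ _).
  rewrite subr0 normrM ler_wpM2r// dfM//.
  by move: c0u; rewrite in_itv/= => /andP[c0 cu]; rewrite !ger0_norm.
have [c cu0 E] := MVT_segment (ltW u0) (fun x _ => fdf x) (cf _ _).
rewrite distrC E sub0r normrM normrN ler_wpM2r// dfM//.
move: cu0; rewrite in_itv/= => /andP[uc c0].
by rewrite (ltr0_norm u0) (ler0_norm c0) lerN2.
Qed.

Lemma expR_taylor0 (u : R) : `|u| <= 1 / 2 -> `|expR u - 1| <= 2 * `|u|.
Proof.
move=> u2; rewrite -[X in _ - X]expR0; apply: mean_value_bound => x xu.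
rewrite ger0_norm ?expR_ge0//.
have x2 : x <= 1 / 2 by apply: le_trans (ler_norm x) (le_trans xu u2).
(* Since [expR (- x) >= 1 - x >= 1 / 2], the derivative is at most 2. *)
have := expR_ge1Dx (- x); rewrite expRN => h.
have ex := expR_gt0 x.
have : (1 / 2) * expR x <= (expR x)^-1 * expR x.
  by rewrite ler_pM2r//; lra.
by rewrite mulVf ?gt_eqF//; lra.
Qed.

Lemma expR_taylor1 (u : R) : `|u| <= 1 / 2 ->
  `|expR u - 1 - u| <= 2 * `|u| ^+ 2.
Proof.
move=> u2.
have := @mean_value_bound (fun x => expR x - 1 - x) (fun x => expR x - 1) (2 * `|u|) u.
rewrite expR0 subrr !subr0 -mulrA -expr2; apply.
  move=> x; rewrite (_ : (fun x : R => _) = expR - cst 1 - id)//.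
  by apply: is_derive_eq; rewrite subr0.
move=> x xu; apply: le_trans (expR_taylor0 (le_trans xu u2)) _.
by rewrite ler_pM2l.
Qed.

Lemma expR_taylor2 (u : R) : `|u| <= 1 / 2 ->
  `|expR u - (1 + u + u ^+ 2 / 2)| <= 2 * `|u| ^+ 3.
Proof.
move=> u2.
have := @mean_value_bound (fun x => expR x - 1 - x - x ^+ 2 / 2)
  (fun x => expR x - 1 - x) (2 * `|u| ^+ 2) u.
rewrite expR0 subrr expr0n/= mul0r !subr0 => H.
rewrite (_ : 2 * `|u| ^+ 3 = 2 * `|u| ^+ 2 * `|u|); last by rewrite -mulrA -exprSr.
have -> : expR u - (1 + u + u ^+ 2 / 2) = expR u - 1 - u - u ^+ 2 / 2 by lra.
apply: H.
  move=> x.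
  rewrite (_ : (fun x : R => _) = expR - cst 1 - id - (2^-1 : R) *: (@id R ^+ 2)).
    by apply: is_derive_eq; rewrite subr0 expr1 /GRing.scale/=; lra.
  by apply/funext => y; rewrite !fctE /GRing.scale/= mulrC.
move=> x xu; apply: le_trans (expR_taylor1 (le_trans xu u2)) _.
by rewrite ler_pM2l// lerXn2r ?nnegrE.
Qed.

Lemma expR_le_quadratic (u b : R) : `|u| <= b -> b <= 1 / 2 ->
  1 + u + u ^+ 2 / 2 - 2 * b ^+ 3 <= expR u <= 1 + u + u ^+ 2 / 2 + 2 * b ^+ 3.
Proof.
move=> ub b2; have := expR_taylor2 (le_trans ub b2).
have : `|u| ^+ 3 <= b ^+ 3 by rewrite lerXn2r ?nnegrE// (le_trans _ ub).
by rewrite ler_norml; lra.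
Qed.

(** First [w - w ^+ 2 <= w / (1 + w)]; then [expR (- v) >= 1 - v] at [v = w / (1 + w)], inverted.
    This turns lower bounds for moment generating functions into exponentials. *)
Lemma expR_le1D (w : R) : 0 <= w -> expR (w - w ^+ 2) <= 1 + w.
Proof.
move=> w0; have w1 : 0 < 1 + w by rewrite ltr_pwDl.
apply: (@le_trans _ _ (expR (w / (1 + w)))).
  by rewrite ler_expR ler_pdivlMr//; nra.
have := expR_ge1Dx (- (w / (1 + w))).
rewrite expRN (_ : 1 + - (w / (1 + w)) = (1 + w)^-1); last by field; rewrite gt_eqF.
by rewrite lef_pV2// posrE ?expR_gt0.
Qed.

End exponential.

(** * Exponential moments of sums over rows *)

Section row_sums.
Context d (T : measurableType d) (R : realType) (P : probability T R).
Context (X : nat * nat -> T -> R).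
Hypothesis mX : forall k, measurable_fun setT (X k).
Hypothesis indep : forall (F : {fset nat * nat}) (B : nat * nat -> set R),
  (forall k, k \in F -> measurable (B k)) ->
  P (\bigcap_(k in [set` F]) (X k @^-1` B k)) =
  (\prod_(k <- F) P (X k @^-1` B k))%E.

Definition index_row (i : nat) : set (nat * nat) := [set k | k.1 = i].

(** As [z k] only involves row [k], the terms are independent. Entries of a column, their centered
    squares, products of two columns, and products of a column with a sum of two others will all be
    families of this kind. *)
Definition centered_row_family (B v : R) (z : nat -> T -> R) :=
  [/\ forall k, depends_on X (index_row k) (z k),
      forall k w, `|z k w| <= B,
      forall k, mean P (z k) = 0 &
      forall k, mean P (fun w => z k w ^+ 2) <= v].

(** The sum over the rows below [n] and the term of row [n] depend on disjoint sets of indices, so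
    the last factor splits off by [mean_prod]. *)
Lemma mgf_prod (z : nat -> T -> R) n lam :
  (forall k, depends_on X (index_row k) (z k)) ->
  mean P (fun w => expR (lam * \sum_(k < n) z k w)) =
  \prod_(k < n) mean P (fun w => expR (lam * z k w)).
Proof.
move=> dz; elim: n => [|n IHn].
  rewrite big_ord0 -[RHS](mean_cst P); apply: eq_mean => w.
  by rewrite big_ord0 mulr0 expR0.
rewrite big_ord_recr/= -IHn.
rewrite -(@mean_prod _ _ _ _ _ X mX indep [set k | (k.1 < n)%N] (index_row n)).
- by apply: eq_mean => w; rewrite big_ord_recr/= mulrDr expRD.
- by apply/seteqP; split => // -[i j] [/= + E]; rewrite (E : i = n) ltnn.
- apply: bounded_measurable_expR; apply: bounded_measurableZ.
  apply: bounded_measurable_sum => k; apply: depends_onS (dz k) => -[i j] ik.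
  by rewrite /= (ik : i = k).
- by apply: bounded_measurable_expR; apply: bounded_measurableZ; exact: dz.
Qed.

Section moment_generating.
Variables (B v : R) (z : nat -> T -> R).
Hypothesis B1 : 1 <= B.
Hypothesis zP : centered_row_family B v z.

(** The term [2 * B ^+ 3] is the Taylor remainder of [expR_le_quadratic]; the extra 1 pays for the
    square lost to [expR_le1D] in [mgf_ge]. *)
Local Notation c := (2 * B ^+ 3 + 1).

Let B3 : 1 <= B ^+ 3. Proof. by rewrite exprn_ege1. Qed.

Let smallB lam : 0 <= lam -> lam * c <= 1 / 2 -> lam * B <= 1 / 2.
Proof.
move=> lam0; apply: le_trans; rewrite ler_wpM2l//.
have B2 : 1 <= B ^+ 2 by rewrite exprn_ege1.
have : B <= B ^+ 3 by rewrite exprS ler_peMr// (le_trans ler01).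
by have := B1; lra.
Qed.

Let mz k : bounded_measurable (z k).
Proof. by case: zP => dz _ _ _; exact: depends_on_measurable (dz k). Qed.

(** The pointwise quadratic bounds on the exponential are averaged; the linear term vanishes because
    [z k] is centered. *)
Let mgf_quadratic lam k : 0 <= lam -> lam * c <= 1 / 2 ->
  1 + lam ^+ 2 / 2 * mean P (fun w => z k w ^+ 2) - 2 * B ^+ 3 * lam ^+ 3 <=
  mean P (fun w => expR (lam * z k w)) <=
  1 + lam ^+ 2 / 2 * mean P (fun w => z k w ^+ 2) + 2 * B ^+ 3 * lam ^+ 3.
Proof.
move=> lam0 lamc; case: zP => dz zB z0 zv.
have lamB := smallB lam0 lamc.
have bc (r : R) := @bounded_measurable_cst _ T R r.
have bz2 := bounded_measurableX 2 (mz k).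
have qE (r : R) : mean P (fun w => lam * z k w + (lam ^+ 2 / 2 * z k w ^+ 2 + r)) =
    lam ^+ 2 / 2 * mean P (fun w => z k w ^+ 2) + r.
  rewrite !meanD ?meanZ ?mean_cst ?z0 ?mulr0 ?add0r//.
  - exact: bounded_measurableZ.
  - exact: bounded_measurableZ.
  - by apply: bounded_measurableD => //; exact: bounded_measurableZ.
have bq (r : R) :
    bounded_measurable (fun w => lam * z k w + (lam ^+ 2 / 2 * z k w ^+ 2 + r)).
  apply: bounded_measurableD; first exact: bounded_measurableZ.
  by apply: bounded_measurableD => //; exact: bounded_measurableZ.
have be : bounded_measurable (fun w => expR (lam * z k w)).
  exact/bounded_measurable_expR/bounded_measurableZ.
have lamz w : `|lam * z k w| <= lam * B.
  by rewrite normrM (ger0_norm lam0) ler_wpM2l.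
have ptw w : 1 + lam * z k w + (lam * z k w) ^+ 2 / 2 - 2 * (lam * B) ^+ 3
    <= expR (lam * z k w)
    <= 1 + lam * z k w + (lam * z k w) ^+ 2 / 2 + 2 * (lam * B) ^+ 3.
  exact: expR_le_quadratic.
apply/andP; split.
- rewrite (_ : _ - _ = lam ^+ 2 / 2 * mean P (fun w => z k w ^+ 2) +
    (1 - 2 * B ^+ 3 * lam ^+ 3)); last by ring.
  rewrite -qE; apply: le_mean => // w; have /andP[+ _] := ptw w.
  by apply: le_trans; rewrite !exprMn; lra.
- rewrite (_ : 1 + _ + _ = lam ^+ 2 / 2 * mean P (fun w => z k w ^+ 2) +
    (1 + 2 * B ^+ 3 * lam ^+ 3)); last by ring.
  rewrite -qE; apply: le_mean => // w; have /andP[_] := ptw w.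
  by move/le_trans; apply; rewrite !exprMn; lra.
Qed.

Lemma mgf_le n lam : 0 <= lam -> lam * c <= 1 / 2 ->
  mean P (fun w => expR (lam * \sum_(k < n) z k w)) <=
  expR (n%:R * (lam ^+ 2 * v / 2 + c * lam ^+ 3)).
Proof.
move=> lam0 lamc; case: (zP) => dz zB z0 zv.
rewrite mgf_prod// expRM_natl -[X in _ ^+ X]card_ord -prodr_const.
apply: ler_prod => k _; have /andP[_ h] := mgf_quadratic k lam0 lamc.
apply/andP; split.
  by apply: Rintegral_ge0 => w _; exact: expR_ge0.
apply: (le_trans h); apply: le_trans (expR_ge1Dx _).
have : lam ^+ 2 / 2 * mean P (fun w => z k w ^+ 2) <= lam ^+ 2 / 2 * v.
  by rewrite ler_wpM2l// divr_ge0// exprn_ge0.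
have : 0 <= lam ^+ 3 by rewrite exprn_ge0.
by lra.
Qed.

(** Each factor is at least [1 + w] with [w = lam ^+ 2 / 2 - 2 * B ^+ 3 * lam ^+ 3], which is
    nonnegative. Passing to an exponential costs [w ^+ 2], at most [lam ^+ 4 / 4], hence at most
    [lam ^+ 3]. *)
Lemma mgf_ge n lam : (forall k, mean P (fun w => z k w ^+ 2) = 1) ->
  0 <= lam -> lam * c <= 1 / 2 ->
  expR (n%:R * (lam ^+ 2 / 2 - c * lam ^+ 3)) <=
  mean P (fun w => expR (lam * \sum_(k < n) z k w)).
Proof.
move=> z1 lam0 lamc; case: (zP) => dz zB z0 zv; have := B3; move=> b3.
rewrite mgf_prod// expRM_natl -[X in _ ^+ X]card_ord -prodr_const.
apply: ler_prod => k _; rewrite expR_ge0/=.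
have /andP[h _] := mgf_quadratic k lam0 lamc.
apply: le_trans h; rewrite z1 mulr1.
have lam2 : 0 <= lam ^+ 2 by rewrite exprn_ge0.
have E3 : lam ^+ 3 = lam * lam ^+ 2 by rewrite exprS.
have w0 : 0 <= lam ^+ 2 / 2 - 2 * B ^+ 3 * lam ^+ 3.
  rewrite E3; have : (lam * c) * lam ^+ 2 <= 1 / 2 * lam ^+ 2 by rewrite ler_wpM2r.
  have : 0 <= lam * lam ^+ 2 by rewrite mulr_ge0.
  by lra.
rewrite -addrA; apply: le_trans (expR_le1D w0); rewrite ler_expR.
have lam1 : lam <= 1 / 2.
  apply: le_trans lamc; rewrite ler_peMr//; lra.
have w2 : lam ^+ 2 / 2 - 2 * B ^+ 3 * lam ^+ 3 <= lam ^+ 2 / 2.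
  have : 0 <= B ^+ 3 * lam ^+ 3 by apply: mulr_ge0; [exact: le_trans b3 | exact: exprn_ge0].
  by lra.
have : (lam ^+ 2 / 2 - 2 * B ^+ 3 * lam ^+ 3) ^+ 2 <= (lam ^+ 2 / 2) ^+ 2.
  by rewrite lerXn2r// nnegrE; lra.
have : (lam ^+ 2 / 2) ^+ 2 <= lam ^+ 3.
  rewrite E3 exprMn -exprM (_ : lam ^+ (2 * 2) = lam * (lam * lam ^+ 2));
    last by rewrite !exprS; ring.
  have : 0 <= lam * (lam ^+ 2) by rewrite mulr_ge0.
  have : lam * (lam * lam ^+ 2) <= 1 / 2 * (lam * lam ^+ 2) by rewrite ler_wpM2r// mulr_ge0.
  by lra.
by lra.
Qed.

Lemma chernoff n lam a : 0 <= lam -> lam * c <= 1 / 2 ->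
  mean P \1_[set w | a <= \sum_(k < n) z k w] <=
  expR (n%:R * (lam ^+ 2 * v / 2 + c * lam ^+ 3) - lam * a).
Proof.
move=> lam0 lamc.
have bS : bounded_measurable (fun w => \sum_(k < n) z k w).
  by apply: bounded_measurable_sum.
rewrite addrC expRD.
apply: (@le_trans _ _ (expR (- (lam * a)) *
   mean P (fun w => expR (lam * \sum_(k < n) z k w)))).
  have be : bounded_measurable (fun w => expR (lam * \sum_(k < n) z k w)).
    exact/bounded_measurable_expR/bounded_measurableZ.
  rewrite -meanZ//; apply: le_mean; last move=> w.
  - exact/bounded_measurable_indic/measurable_ge.
  - exact: bounded_measurableZ.
  rewrite -expRD indicE; case: (boolP (_ \in _)) => [|_]; last exact: expR_ge0.
  rewrite inE/= => aS; rewrite -[leLHS]expR0 ler_expR.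
  by rewrite addrC -mulrBr mulr_ge0// subr_ge0.
by rewrite ler_pM2l ?expR_gt0// mgf_le.
Qed.

(** [chernoff] at [lam = b * s]: on this scale every exponent is a multiple of [n s^2], which will
    be [ln p]. The tilt [b] stays free; up to the cubic error its best value is [a / v]. *)
Lemma tail_le n s a b : 0 <= s -> 0 <= b -> b * s * c <= 1 / 2 ->
  mean P \1_[set w | a * (n%:R * s) <= \sum_(k < n) z k w] <=
  expR (- (n%:R * s ^+ 2) * (a * b - b ^+ 2 * v / 2 - c * b ^+ 3 * s)).
Proof.
move=> s0 b0 bsc; apply: le_trans (chernoff _ _ (mulr_ge0 b0 s0) bsc) _.
by rewrite ler_expR le_eqVlt; apply/orP; left; apply/eqP; rewrite !exprMn; ring.
Qed.

End moment_generating.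

(** Put [b = a + eta] and [L = n s^2]. The exponential moment at [b * s] is at least
    [expR (L * (b ^+ 2 / 2 - eta ^+ 2 / 8))]. Comparison with the tilts [a] and [b + eta] bounds its
    share on each side of [[A, A']] by a quarter of that quantity. So at least half of that quantity
    sits on the interval, where the weight is at most [expr] of [b * s * A'], with [expr] the
    exponential. *)
Lemma tail_ge (B : R) (z : nat -> T -> R) n s a eta :
  1 <= B -> centered_row_family B 1 z ->
  (forall k, mean P (fun w => z k w ^+ 2) = 1) ->
  0 <= s -> 0 <= a -> 0 <= eta ->
  (a + 2 * eta) * s * (2 * B ^+ 3 + 1) <= 1 / 2 ->
  (2 * B ^+ 3 + 1) * (a + 2 * eta) ^+ 3 * s <= eta ^+ 2 / 8 ->
  expR (- (n%:R * s ^+ 2) * (eta ^+ 2 / 4)) <= 1 / 4 ->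
  expR (- (n%:R * s ^+ 2) *
    ((a + eta) ^+ 2 / 2 + (a + eta) * eta + eta ^+ 2 / 8)) / 2 <=
  mean P \1_[set w | a * (n%:R * s) <= \sum_(k < n) z k w].
Proof.
move=> B1 zP z1 s0 a0 eta0; set c := 2 * B ^+ 3 + 1 => bsc bs8 L4.
case: (zP) => dz zB z0 zv.
have c0 : 0 <= c by have : 1 <= B ^+ 3 by [rewrite exprn_ege1]; rewrite /c; lra.
set S := fun w => \sum_(k < n) z k w.
have bS : bounded_measurable S.
  by apply: bounded_measurable_sum => k; exact: depends_on_measurable (dz k).
have be r : bounded_measurable (fun w => expR (r * S w)).
  exact/bounded_measurable_expR/bounded_measurableZ.
pose b := a + eta; set L := n%:R * s ^+ 2 in L4 *.
have L0 : 0 <= L by rewrite mulr_ge0// exprn_ge0.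
have small t : 0 <= t -> t <= a + 2 * eta ->
    t * s * c <= 1 / 2 /\ L * (c * t ^+ 3 * s) <= L * (eta ^+ 2 / 8).
  move=> t0 tb; split.
    by apply: le_trans bsc; rewrite ler_wpM2r// ler_wpM2r.
  rewrite ler_wpM2l//; apply: le_trans bs8; rewrite ler_wpM2r// ler_wpM2l// lerXn2r// nnegrE.
  exact: le_trans tb.
have mle t : 0 <= t -> t <= a + 2 * eta ->
    mean P (fun w => expR (t * s * S w)) <= expR (L * (t ^+ 2 / 2 + eta ^+ 2 / 8)).
  move=> t0 tb; have [h1 h2] := small t t0 tb.
  apply: le_trans (mgf_le B1 zP n (mulr_ge0 t0 s0) h1) _.
  rewrite ler_expR -/c mulr1 [leRHS]mulrDr; apply: le_trans (lerD (lexx _) h2).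
  by rewrite le_eqVlt; apply/orP; left; apply/eqP; rewrite /L !exprMn; ring.
have mge : expR (L * (b ^+ 2 / 2 - eta ^+ 2 / 8)) <=
    mean P (fun w => expR (b * s * S w)).
  have b0 : 0 <= b by rewrite /b; lra.
  have [h1 h2] := small b b0 (ltac:(rewrite /b; lra)).
  apply: le_trans (mgf_ge B1 zP n z1 (mulr_ge0 b0 s0) h1).
  rewrite ler_expR -/c [leLHS]mulrBr; apply: le_trans (lerB (lexx _) h2) _.
  by rewrite le_eqVlt; apply/orP; left; apply/eqP; rewrite /L !exprMn; ring.
(* Under the tilt [b * s] the sum concentrates near [b * (n%:R * s)]; [A] and [A'] lie [eta] units
   of [n%:R * s] below and above that point. *)
pose A := a * (n%:R * s); pose A' := (b + eta) * (n%:R * s).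
have ns0 : 0 <= n%:R * s by rewrite mulr_ge0.
(* Outside [A <= S <= A'] one of the two subtracted exponentials
   exceeds [expR (b s S)]. *)
have ptw w : expR (b * s * S w) - expR (- (eta * s * A')) * expR ((b + eta) * s * S w)
      - expR (eta * s * A) * expR (a * s * S w) <=
    expR (b * s * A') * \1_[set w | A <= S w] w.
  have etas : 0 <= eta * s by rewrite mulr_ge0.
  have bs : 0 <= b * s by rewrite mulr_ge0// /b; lra.
  rewrite -!expRD indicE.
  set u := expR (_ + (b + eta) * s * S w); set u' := expR (_ + a * s * S w).
  have u0 : 0 <= u by exact: expR_ge0.
  have u'0 : 0 <= u' by exact: expR_ge0.
  have [SA|AS] := ltP (S w) A.
    have : expR (b * s * S w) <= u'.
      rewrite ler_expR; have : 0 <= eta * s * (A - S w) by rewrite mulr_ge0 ?subr_ge0// ltW.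
      by rewrite /b; lra.
    have -> : (w \in [set w | A <= S w]) = false.
      by apply/negbTE; rewrite notin_setE/= => AS; move: SA; rewrite ltNge AS.
    by rewrite mulr0; lra.
  rewrite mem_set// mulr1.
  have [SA'|A'S] := leP (S w) A'.
    have : expR (b * s * S w) <= expR (b * s * A') by rewrite ler_expR ler_wpM2l.
    by lra.
  have : expR (b * s * S w) <= u.
    rewrite ler_expR; have : 0 <= eta * s * (S w - A') by rewrite mulr_ge0 ?subr_ge0// ltW.
    by lra.
  by have := expR_ge0 (b * s * A'); lra.
have tail1 : expR (- (eta * s * A')) * mean P (fun w => expR ((b + eta) * s * S w)) <=
    expR (L * (b ^+ 2 / 2 - 3 * eta ^+ 2 / 8)).
  apply: le_trans (ler_wpM2l (expR_ge0 _) (mle _ _ _)) _; [rewrite /b; lra..|].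
  rewrite -expRD ler_expR le_eqVlt; apply/orP; left; apply/eqP.
  by rewrite /A' /L; field.
have tail2 : expR (eta * s * A) * mean P (fun w => expR (a * s * S w)) <=
    expR (L * (b ^+ 2 / 2 - 3 * eta ^+ 2 / 8)).
  apply: le_trans (ler_wpM2l (expR_ge0 _) (mle _ _ _)) _; [lra..|].
  rewrite -expRD ler_expR le_eqVlt; apply/orP; left; apply/eqP.
  by rewrite /A /b /L; field.
have bind : bounded_measurable (\1_[set w | A <= S w] : T -> R).
  exact/bounded_measurable_indic/measurable_ge.
have : expR (L * (b ^+ 2 / 2 - eta ^+ 2 / 8)) / 2 <=
    expR (b * s * A') * mean P \1_[set w | A <= S w].
  have bu := bounded_measurableZ (expR (- (eta * s * A'))) (be ((b + eta) * s)).
  have bu' := bounded_measurableZ (expR (eta * s * A)) (be (a * s)).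
  have bd := bounded_measurableB (be (b * s)) bu.
  rewrite -meanZ//; apply: le_trans (le_mean _ _ _ ptw).
  - rewrite !meanB// !meanZ//.
  have E : expR (L * (b ^+ 2 / 2 - 3 * eta ^+ 2 / 8)) =
      expR (L * (b ^+ 2 / 2 - eta ^+ 2 / 8)) * expR (- L * (eta ^+ 2 / 4)).
    by rewrite -expRD; congr expR; field.
  have : expR (L * (b ^+ 2 / 2 - 3 * eta ^+ 2 / 8)) <=
      expR (L * (b ^+ 2 / 2 - eta ^+ 2 / 8)) * (1 / 4).
    by rewrite E ler_wpM2l// expR_ge0.
  by lra.
  - exact: bounded_measurableB.
  - exact: bounded_measurableZ.
move=> le_mA; rewrite -(ler_pM2l (expR_gt0 (b * s * A'))).
apply: le_trans le_mA; rewrite mulrA -expRD ler_pM2r// ler_expR.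
by rewrite le_eqVlt; apply/orP; left; apply/eqP; rewrite /A' /L /b; field.
Qed.

End row_sums.

(** * Second moment method over a square array of pairs *)

Section second_moment.
Context d (T : measurableType d) (R : realType) (P : probability T R).

Lemma measurable_forall_notin (I : finType) (E : I -> set T) :
  (forall e, measurable (E e)) -> measurable [set w | forall e, ~ E e w].
Proof.
move=> mE; have -> : [set w | forall e, ~ E e w] = \bigcap_(e in setT) ~` E e.
  by apply/seteqP; split => [w h e _|w h e]; [exact: h | exact: (h e Logic.I)].
apply: fin_bigcap_measurable; first exact: finite_finset.
by move=> e _; exact: measurableC.
Qed.

(** Chebyshev's argument: when no event occurs, the centered count equals [- mu], so [mu ^+ 2] times
    the probability is at most the sum of all covariances. These vanish for pairs differing in both
    coordinates. Each [e] contributes at most [p e] from itself and [2 * m * r] from the pairs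
    sharing a coordinate with it. *)
Lemma second_moment (m : nat) (E : 'I_m * 'I_m -> set T) (q r : R) :
  (0 < m)%N -> 0 < q -> 0 <= r ->
  (forall e, measurable (E e)) ->
  (forall e, q <= mean P \1_(E e)) ->
  (forall e e', e.1 != e'.1 -> e.2 != e'.2 ->
    mean P (fun w => \1_(E e) w * \1_(E e') w) =
    mean P \1_(E e) * mean P \1_(E e')) ->
  (forall e e', e != e' -> (e.1 == e'.1) || (e.2 == e'.2) ->
    mean P (fun w => \1_(E e) w * \1_(E e') w) <= r) ->
  mean P \1_[set w | forall e, ~ E e w] <=
  (m%:R ^+ 2 * q)^-1 + 2 * r / (m%:R * q ^+ 2).
Proof.
move=> m0 q0 r0 mE qE dE sE.
have mR : 0 < m%:R :> R by rewrite ltr0n.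
have bE e : bounded_measurable (\1_(E e) : T -> R).
  exact: bounded_measurable_indic.
have bEE e e' : bounded_measurable (fun w => \1_(E e) w * \1_(E e') w : R).
  exact: bounded_measurableM.
pose p e := mean P \1_(E e); pose mu := \sum_e p e.
have p0 e : 0 <= p e by rewrite (le_trans (ltW q0)) ?qE.
have mu_ge : m%:R ^+ 2 * q <= mu.
  have -> : m%:R ^+ 2 * q = \sum_(e : 'I_m * 'I_m) q.
    by rewrite sumr_const card_prod card_ord -[in RHS]mulr_natl natrM expr2.
  by apply: ler_sum => e _; exact: qE.
have mu0 : 0 < mu by rewrite (lt_le_trans _ mu_ge)// mulr_gt0// exprn_gt0.
set A := [set w | _].
have mA : measurable A by exact: measurable_forall_notin.
have bA : bounded_measurable (\1_A : T -> R) by exact: bounded_measurable_indic.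
pose D e e' w : R := (\1_(E e) w - p e) * (\1_(E e') w - p e').
have bD1 e : bounded_measurable (fun w => \1_(E e) w - p e).
  by apply: bounded_measurableB => //; exact: bounded_measurable_cst.
have bD e e' : bounded_measurable (D e e') by exact: bounded_measurableM.
have meanD' e e' : mean P (D e e') =
    mean P (fun w => \1_(E e) w * \1_(E e') w) - p e * p e'.
  rewrite (@eq_mean _ _ _ P _ (fun w => \1_(E e) w * \1_(E e') w -
     (p e' * \1_(E e) w + p e * \1_(E e') w - p e * p e'))); last by move=> w; rewrite /D; ring.
  have bc := @bounded_measurable_cst _ T R (p e * p e').
  have b1 := bounded_measurableZ (p e') (bE e).
  have b2 := bounded_measurableZ (p e) (bE e').
  have b3 := bounded_measurableD b1 b2.
  rewrite meanB//; last exact: bounded_measurableB.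
  by rewrite meanB// meanD// mean_cst !meanZ// -/(p e) -/(p e'); ring.
(* One bound for all cases, written with indicators so that it can be summed; the cases overlap on
   the diagonal, which is harmless since [r >= 0]. *)
have cov_le e e' : mean P (D e e') <=
    (e' == e)%:R * p e + (e'.1 == e.1)%:R * r + (e'.2 == e.2)%:R * r.
  have pp : 0 <= p e * p e' by rewrite mulr_ge0.
  rewrite meanD'; have [->|ne] := eqVneq e' e.
    have -> : mean P (fun w => \1_(E e) w * \1_(E e) w) = p e.
      by apply: eq_mean => w; rewrite indicE; case: (_ \in _); rewrite ?mulr0 ?mulr1.
    by rewrite !eqxx !mul1r; have := mulr_ge0 (p0 e) (p0 e); lra.
  have [e1|n1] := eqVneq e'.1 e.1.
    have := sE e e'; rewrite eq_sym ne e1 eqxx => /(_ isT isT) h.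
    by case: (_ == _); rewrite ?mul1r ?mul0r; lra.
  have [e2|n2] := eqVneq e'.2 e.2.
    have := sE e e'; rewrite eq_sym ne e2 eqxx orbT => /(_ isT isT) h.
    by rewrite ?mul1r ?mul0r; lra.
  by rewrite dE 1?eq_sym// subrr !mul0r !addr0.
have sumD e : \sum_e' mean P (D e e') <= p e + 2 * (m%:R * r).
  apply: le_trans (ler_sum _ (fun e' _ => cov_le e e')) _.
  rewrite !big_split/= (bigD1 e)//= eqxx mul1r big1 ?addr0; last first.
    by move=> e' /negbTE->; rewrite mul0r.
  rewrite -addrA lerD2l.
  have -> : \sum_(e' : 'I_m * 'I_m) (e'.1 == e.1)%:R * r = m%:R * r.
    rewrite -(pair_bigA _ (fun i j => (i == e.1)%:R * r))/=.
    rewrite (bigD1 e.1)//= [X in _ + X]big1 ?addr0; last first.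
      by move=> i /negbTE->; rewrite big1// => j _; rewrite mul0r.
    by rewrite sumr_const card_ord eqxx mul1r mulr_natl.
  have -> : \sum_(e' : 'I_m * 'I_m) (e'.2 == e.2)%:R * r = m%:R * r.
    rewrite -(pair_bigA _ (fun i j => (j == e.2)%:R * r))/=.
    rewrite exchange_big/= (bigD1 e.2)//= [X in _ + X]big1 ?addr0; last first.
      by move=> i /negbTE->; rewrite big1// => j _; rewrite mul0r.
    by rewrite sumr_const card_ord eqxx mul1r mulr_natl.
  by lra.
have mainle : mu ^+ 2 * mean P \1_A <= mu + 2 * m%:R ^+ 3 * r.
  apply: (@le_trans _ _ (\sum_e \sum_e' mean P (D e e'))); last first.
    apply: le_trans (ler_sum _ (fun e _ => sumD e)) _.
    rewrite big_split/= sumr_const card_prod card_ord -[X in _ + X <= _]mulr_natl natrM.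
    by rewrite -/mu; lra.
  have -> : \sum_e \sum_e' mean P (D e e') =
      mean P (fun w => \sum_e \sum_e' D e e' w).
    rewrite mean_sum; last by move=> e; exact: bounded_measurable_sum.
    by apply: eq_bigr => e _; rewrite mean_sum.
  rewrite -meanZ//; apply: le_mean.
  - exact: bounded_measurableZ.
  - by apply: bounded_measurable_sum => e; exact: bounded_measurable_sum.
  move=> w.
  have -> : \sum_e \sum_e' D e e' w = (\sum_e (\1_(E e) w - p e)) ^+ 2.
    rewrite expr2 big_distrl/=; apply: eq_bigr => e _.
    by rewrite big_distrr.
  rewrite [X in _ * X]indicE; case: (boolP (_ \in _)) => [|_]; last by rewrite mulr0 sqr_ge0.
  rewrite inE/= => Aw; rewrite mulr1 sumrB big1 ?sub0r ?sqrrN// => e _.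
  by rewrite indicE memNset.
have h1 : mean P \1_A <= mu^-1 + 2 * m%:R ^+ 3 * r / mu ^+ 2.
  rewrite (_ : _ + _ = (mu + 2 * m%:R ^+ 3 * r) / mu ^+ 2); last by field; rewrite gt_eqF.
  by rewrite ler_pdivlMr ?exprn_gt0// mulrC.
apply: (le_trans h1); apply: lerD.
  by rewrite lef_pV2// posrE// mulr_gt0// exprn_gt0.
have -> : 2 * r / (m%:R * q ^+ 2) = 2 * m%:R ^+ 3 * r / (m%:R ^+ 2 * q) ^+ 2.
  by field; rewrite !gt_eqF.
rewrite ler_wpM2l// ?mulr_ge0// ?exprn_ge0// ?ler0n//.
rewrite lef_pV2 ?posrE ?exprn_gt0 ?mulr_gt0 ?exprn_gt0//.
rewrite lerXn2r// nnegrE ?ltW//.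
by rewrite mulr_gt0// exprn_gt0.
Qed.

End second_moment.

(** * Sample correlations of well-behaved data *)

Section deterministic.
Context (R : realType).

Definition col_sum (y : nat -> nat -> R) n j : R := \sum_(k < n) y k j.
Definition col_dot (y : nat -> nat -> R) n i j : R := \sum_(k < n) y k i * y k j.

(** Centering removes [mu], and [sigma ^+ 2] cancels between numerator and norms. The centered
    products are expanded into plain sums, the quantities controlled by tail bounds. Constant
    columns are covered, both sides being 0. *)
Lemma sample_correlation_affine (x y : nat -> nat -> R) (mu sigma : R) n p (i j : 'I_p) :
  (0 < n)%N -> sigma != 0 ->
  (forall k l, (k < n)%N -> (l < p)%N -> x k l = mu + sigma * y k l) ->
  sample_correlation (\matrix_(k < n, l < p) x k l) i j =
  (col_dot y n i j - col_sum y n i * col_sum y n j / n%:R) /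
  (Num.sqrt (col_dot y n i i - col_sum y n i ^+ 2 / n%:R) *
   Num.sqrt (col_dot y n j j - col_sum y n j ^+ 2 / n%:R)).
Proof.
move=> n0 s0 xy; have nR : n%:R != 0 :> R by rewrite pnatr_eq0 -lt0n.
have cE (l : 'I_p) (k : 'I_n) : centered (col l (\matrix_(k < n, l < p) x k l)) k 0 =
    sigma * (y k l - col_sum y n l / n%:R).
  rewrite /centered !mxE /sample_mean.
  under eq_bigr do rewrite !mxE xy//.
  rewrite big_split/= sumr_const card_ord -mulr_sumr -/(col_sum y n l) xy//.
  by rewrite -mulr_natl; field.
have dotE (l l' : 'I_p) :
    \sum_(k < n) (y k l - col_sum y n l / n%:R) * (y k l' - col_sum y n l' / n%:R) =
    col_dot y n l l' - col_sum y n l * col_sum y n l' / n%:R.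
  transitivity (\sum_(k < n) (y k l * y k l' - (col_sum y n l' / n%:R * y k l +
     col_sum y n l / n%:R * y k l' - col_sum y n l / n%:R * (col_sum y n l' / n%:R)))).
    by apply: eq_bigr => k _; ring.
  rewrite !sumrB big_split/= -!mulr_sumr sumr_const card_ord.
  rewrite -/(col_dot y n l l') -/(col_sum y n l) -/(col_sum y n l') -mulr_natl.
  by field.
have normE (l : 'I_p) : euclidean_norm (centered (col l (\matrix_(k < n, l < p) x k l))) =
    `|sigma| * Num.sqrt (col_dot y n l l - col_sum y n l ^+ 2 / n%:R).
  rewrite /euclidean_norm -sqrtr_sqr -sqrtrM ?sqr_ge0// expr2 -dotE mulr_sumr.
  by congr Num.sqrt; apply: eq_bigr => k _; rewrite cE; ring.
rewrite mxE !normE mxE.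
under eq_bigr do rewrite mxE !cE.
rewrite (_ : \sum_(k < n) _ =
    sigma ^+ 2 * (col_dot y n i j - col_sum y n i * col_sum y n j / n%:R)); last first.
  by rewrite -dotE mulr_sumr; apply: eq_bigr => k _; ring.
rewrite mulrACA -expr2 real_normK ?num_real//.
by rewrite -mulf_div divff ?mul1r// expf_neq0.
Qed.

(** The purely deterministic part: centering changes scalar products by at most
    [A ^+ 2 * n * s ^+ 2], and the norms are [sqrt n] up to a relative error of order [s]. The
    smallness condition on [s] absorbs both errors into [eps / 2]. *)
Lemma coherence_near2 (x y : nat -> nat -> R) (mu sigma A s eps : R) n p :
  (0 < n)%N -> sigma != 0 ->
  (forall k l, (k < n)%N -> (l < p)%N -> x k l = mu + sigma * y k l) ->
  0 < s -> s <= 1 -> 0 <= A -> eps <= 1 -> s * (4 * A ^+ 2 + 3 * A) < eps / 2 ->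
  (forall i, (i < p)%N -> `|col_sum y n i| <= A * (n%:R * s)) ->
  (forall i, (i < p)%N -> `|col_dot y n i i - n%:R| <= A * (n%:R * s)) ->
  (forall i j, (i < j)%N -> (j < p)%N ->
     `|col_dot y n i j| <= (2 + eps / 2) * (n%:R * s)) ->
  (exists i j, [/\ (i < j)%N, (j < p)%N &
     (2 - eps / 2) * (n%:R * s) <= col_dot y n i j]) ->
  `|s^-1 * coherence (\matrix_(k < n, l < p) x k l) - 2| < eps.
Proof.
move=> n0 sg0 xy s0 s1 A0 eps1 sA Mle Qle Sle [i0 [j0 [ij0 jp0 Sge]]].
have nR : 0 < n%:R :> R by rewrite ltr0n.
have As0 : 0 <= A * s by rewrite mulr_ge0// ltW.
have AAs0 : 0 <= A ^+ 2 * s by rewrite mulr_ge0 ?sqr_ge0// ltW.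
have AAss : A ^+ 2 * s * s <= A ^+ 2 * s by rewrite ler_piMr.
have eps0 : 0 < eps.
  have : 0 <= s * (4 * A ^+ 2 + 3 * A) by lra.
  by lra.
pose D i := col_dot y n i i - col_sum y n i ^+ 2 / n%:R.
(* [k1] also accounts for the subtracted square of the column sum; in the upper bound [k2] that term
   has a favourable sign. *)
pose k1 := 1 - A * s - A ^+ 2 * s * s; pose k2 := 1 + A * s.
have k1_gt0 : 0 < k1 by rewrite /k1; lra.
have MM i j : (i < p)%N -> (j < p)%N ->
    `|col_sum y n i * col_sum y n j / n%:R| <= A ^+ 2 * (n%:R * s) * s.
  move=> ip jp; rewrite normrM normfV (ger0_norm (ltW nR)) ler_pdivrMr//.
  apply: (@le_trans _ _ ((A * (n%:R * s)) * (A * (n%:R * s)))).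
    by rewrite normrM ler_pM ?Mle.
  by rewrite le_eqVlt; apply/orP; left; apply/eqP; ring.
have DB i : (i < p)%N -> n%:R * k1 <= D i <= n%:R * k2.
  move=> ip; have := MM i i ip ip; have := Qle i ip; rewrite !ler_norml -expr2.
  have : 0 <= col_sum y n i ^+ 2 / n%:R by rewrite divr_ge0 ?sqr_ge0// ltW.
  by rewrite /D /k1 /k2; lra.
have sqB i j : (i < p)%N -> (j < p)%N ->
    n%:R * k1 <= Num.sqrt (D i) * Num.sqrt (D j) <= n%:R * k2.
  move=> ip jp; have /andP[il iu] := DB i ip; have /andP[jl ju] := DB j jp.
  have k10 : 0 <= n%:R * k1 by rewrite mulr_ge0// ltW.
  have k20 : 0 <= n%:R * k2 by rewrite mulr_ge0// /k2; lra.
  apply/andP; split.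
    rewrite -[leLHS]sqr_sqrtr// expr2 ler_pM ?sqrtr_ge0// ler_wsqrtr//.
  by rewrite -[leRHS]sqr_sqrtr// expr2 ler_pM ?sqrtr_ge0// ler_wsqrtr.
have rhoE (i j : 'I_p) : sample_correlation (\matrix_(k < n, l < p) x k l) i j =
    (col_dot y n i j - col_sum y n i * col_sum y n j / n%:R) /
    (Num.sqrt (D i) * Num.sqrt (D j)) by rewrite (sample_correlation_affine i j n0 sg0 xy).
rewrite ltr_norml; apply/andP; split.
(* For the lower bound the single pair with a large scalar product suffices. *)
- pose i1 : 'I_p := Ordinal (ltn_trans ij0 jp0); pose j1 : 'I_p := Ordinal jp0.
  have coh : `|sample_correlation (\matrix_(k < n, l < p) x k l) i1 j1| <=
      coherence (\matrix_(k < n, l < p) x k l).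
    exact: (le_bigmax_cond _ (fun k : 'I_p * 'I_p =>
      `|sample_correlation (\matrix_(k < n, l < p) x k l) k.1 k.2|) (j := (i1, j1))).
  have /andP[sl su] := sqB i1 j1 (ltn_trans ij0 jp0) jp0.
  have sq0 : 0 < Num.sqrt (D i1) * Num.sqrt (D j1).
    by apply: lt_le_trans sl; rewrite mulr_gt0.
  suff : (2 - eps) * s < coherence (\matrix_(k < n, l < p) x k l).
    by rewrite -ltr_pdivlMr// mulrC; lra.
  apply: lt_le_trans coh; apply: lt_le_trans (ler_norm _).
  rewrite rhoE ltr_pdivlMr//.
  apply: (@le_lt_trans _ _ ((2 - eps) * s * (n%:R * k2))).
    by rewrite ler_wpM2l// mulr_ge0 ?ltW//; lra.
  have := MM i1 j1 (ltn_trans ij0 jp0) jp0; rewrite ler_norml /k2 => /andP[_ mm].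
  have : 0 < (n%:R * s) * (eps / 2 - s * (4 * A ^+ 2 + 3 * A)).
    by rewrite mulr_gt0 ?subr_gt0// mulr_gt0.
  have : 0 <= n%:R * s * (A * s) by rewrite !mulr_ge0// ltW.
  have : 0 <= n%:R * s * (A * s) * eps by rewrite !mulr_ge0// ltW.
  have : 0 <= n%:R * s * (A ^+ 2 * s) by rewrite !mulr_ge0 ?sqr_ge0// ltW.
  by move: Sge; rewrite /=; lra.
- suff : coherence (\matrix_(k < n, l < p) x k l) < (2 + eps) * s.
    by rewrite -ltr_pdivrMr// mulrC; lra.
  (* For the upper bound every pair is estimated uniformly; the maximum starts from 0, so the bound
     must also be nonnegative. *)
  apply: (@le_lt_trans _ _ (s * ((2 + eps / 2 + A ^+ 2 * s) / k1))).
    apply: bigmax_le.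
      by rewrite mulr_ge0 ?(ltW s0)// divr_ge0 ?(ltW k1_gt0)//; lra.
    move=> [i j]/= ij; rewrite rhoE.
    have ip := ltn_ord i; have jp := ltn_ord j.
    have /andP[sl su] := sqB i j ip jp.
    have nk0 : 0 < n%:R * k1 by rewrite mulr_gt0.
    have sq0 : 0 < Num.sqrt (D i) * Num.sqrt (D j) by exact: lt_le_trans sl.
    rewrite normrM normfV (gtr0_norm sq0).
    apply: (@le_trans _ _ (((2 + eps / 2) * (n%:R * s) + A ^+ 2 * (n%:R * s) * s) / (n%:R * k1))).
      apply: ler_pM => //.
        apply: le_trans (ler_normB _ _) _; apply: lerD; [exact: Sle | exact: MM].
      by rewrite lef_pV2.
    rewrite le_eqVlt; apply/orP; left; apply/eqP.
    by field; rewrite !gt_eqF.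
  rewrite mulrC ltr_pM2r// ltr_pdivrMr// /k1.
  have : eps * (A * s) <= A * s by rewrite ler_piMl.
  have : eps * (A ^+ 2 * s * s) <= A ^+ 2 * s * s by rewrite ler_piMl// mulr_ge0// ltW.
  by lra.
Qed.

End deterministic.

(** * Deviations for a bounded standardized array *)

Section fails_within.
Context d (T : measurableType d) (R : realType) (P : probability T R).

(* Phrased through a dominating function so that [Q] need not be measurable. *)
Definition fails_within (Q : T -> Prop) (b : R) :=
  exists g : T -> R, [/\ bounded_measurable g, forall w, 0 <= g w,
    forall w, ~ Q w -> 1 <= g w & mean P g <= b].

Lemma fails_withinW (Q Q' : T -> Prop) b b' : (forall w, Q w -> Q' w) -> b <= b' ->
  fails_within Q b -> fails_within Q' b'.
Proof.
move=> QQ' bb' [g [bg g0 Qg gb]]; exists g; split => //; last exact: le_trans bb'.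
by move=> w Q'w; apply: Qg => /QQ'.
Qed.

Lemma fails_within_and (Q Q' : T -> Prop) b b' :
  fails_within Q b -> fails_within Q' b' ->
  fails_within (fun w => Q w /\ Q' w) (b + b').
Proof.
move=> [g [bg g0 Qg gb]] [h [bh h0 Qh hb]]; exists (fun w => g w + h w); split.
- exact: bounded_measurableD.
- by move=> w; rewrite addr_ge0.
- move=> w /not_andP[/Qg|/Qh] h1.
    by rewrite ler_wpDr.
  by rewrite ler_wpDl.
- by rewrite meanD// lerD.
Qed.

(** The union bound: the dominating functions are added. *)
Lemma fails_within_forall (I : finType) (Q : I -> T -> Prop) b :
  (forall i, fails_within (Q i) b) ->
  fails_within (fun w => forall i, Q i w) (#|I|%:R * b).
Proof.
move=> /choice[g gP]; exists (fun w => \sum_i g i w); split.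
- by apply: bounded_measurable_sum => i; case: (gP i).
- by move=> w; rewrite sumr_ge0// => i _; case: (gP i).
- move=> w /existsNP[i Qi]; rewrite (bigD1 i)//= ler_wpDr//.
    by rewrite sumr_ge0// => j _; case: (gP j).
  by case: (gP i) => _ _ + _; exact.
- rewrite mean_sum; last by move=> i; case: (gP i).
  rewrite mulr_natl -sumr_const; apply: ler_sum => i _.
  by case: (gP i).
Qed.

Lemma fails_within_not (A : set T) b : measurable A -> mean P \1_A <= b ->
  fails_within (fun w => ~ A w) b.
Proof.
move=> mA Ab; exists \1_A; split => //; first exact: bounded_measurable_indic.
by move=> w /contrapT Aw; rewrite indicE mem_set.
Qed.

End fails_within.

(** * Tail bounds for column sums and scalar products of columns *)

Section standardized_array.
Context d (T : measurableType d) (R : realType) (P : probability T R).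
Context (Y : nat * nat -> T -> R) (K : R).
Hypothesis mY : forall k, measurable_fun setT (Y k).
Hypothesis indepY : forall (F : {fset nat * nat}) (B : nat * nat -> set R),
  (forall k, k \in F -> measurable (B k)) ->
  P (\bigcap_(k in [set` F]) (Y k @^-1` B k)) =
  (\prod_(k <- F) P (Y k @^-1` B k))%E.
Hypothesis K1 : 1 <= K.
Hypothesis YK : forall k w, `|Y k w| <= K.
Hypothesis mean0 : forall k, mean P (Y k) = 0.
Hypothesis mean1 : forall k, mean P (fun w => Y k w ^+ 2) = 1.

(** A common bound for the summands of all four families below; the factor 2 is for the product of
    an entry with a sum of two entries. *)
Definition summand_bound := 2 * K ^+ 2.

(* The coefficient of the cubic error term in [mgf_le] and [mgf_ge]. *)
Definition cubic_coef := 2 * summand_bound ^+ 3 + 1.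

Lemma summand_bound_ge1 : 1 <= summand_bound.
Proof.
have h : 1 <= K ^+ 2 by rewrite exprn_ege1.
by rewrite /summand_bound; lra.
Qed.

Lemma cubic_coef_ge1 : 1 <= cubic_coef.
Proof.
have h : 1 <= summand_bound ^+ 3 by rewrite exprn_ege1// summand_bound_ge1.
by rewrite /cubic_coef; lra.
Qed.

Lemma depends_on_Y (I : set (nat * nat)) k : I k -> depends_on Y I (Y k).
Proof.
move=> Ik; apply: (@depends_onS _ _ _ _ _ [set k]); first by move=> l ->.
by apply: depends_on_coord; exists K.
Qed.

Let bY k : bounded_measurable (Y k).
Proof. by split => //; exists K. Qed.

Lemma mean_YY k l : k != l -> mean P (fun w => Y k w * Y l w) = 0.
Proof.
move=> kl; rewrite (@mean_prod _ _ _ _ _ Y mY indepY [set k] [set l]) ?mean0 ?mul0r//.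
- by apply/seteqP; split => // x [-> /= E]; rewrite E eqxx in kl.
- exact: depends_on_Y.
- exact: depends_on_Y.
Qed.

Lemma mean_Y2Y2 k l : k != l -> mean P (fun w => (Y k w * Y l w) ^+ 2) = 1.
Proof.
move=> kl; under eq_mean do rewrite exprMn.
rewrite (@mean_prod _ _ _ _ _ Y mY indepY [set k] [set l]) ?mean1 ?mul1r//.
- by apply/seteqP; split => // x [-> /= E]; rewrite E eqxx in kl.
- by apply: bounded_measurableX; exact: depends_on_Y.
- by apply: bounded_measurableX; exact: depends_on_Y.
Qed.

Lemma centered_row_familyN (b v : R) z : centered_row_family P Y b v z ->
  centered_row_family P Y b v (fun k w => - z k w).
Proof.
move=> [dz zb z0 zv]; split.
- by move=> k; apply: bounded_measurableN; exact: dz.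
- by move=> k w; rewrite normrN.
- move=> k; have bz := depends_on_measurable mY (dz k).
  have := meanZ P (-1) bz; rewrite z0 mulr0 => <-.
  by apply: eq_mean => w; rewrite mulN1r.
- by move=> k; under eq_mean do rewrite sqrrN; exact: zv.
Qed.

Lemma entry_family i : centered_row_family P Y summand_bound 1 (fun k => Y (k, i)).
Proof.
split => //.
- by move=> k; exact: depends_on_Y.
- by move=> k w; apply: le_trans (YK _ _) _; have := K1; rewrite /summand_bound; nra.
- by move=> k; rewrite mean1.
Qed.

(** The variance bound is merely the square of the uniform bound: for squared norms a deviation of
    order [n s] with any constant is good enough. *)
Lemma square_family i :
  centered_row_family P Y summand_bound (summand_bound ^+ 2) (fun k w => Y (k, i) w ^+ 2 - 1).
Proof.
have bX k := bounded_measurableX 2 (bY (k, i)).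
have b1 := @bounded_measurable_cst _ T R 1.
have bd k := bounded_measurableB (bX k) b1.
have zB k w : `|Y (k, i) w ^+ 2 - 1| <= summand_bound.
  have h : Y (k, i) w ^+ 2 <= K ^+ 2.
    by rewrite -real_normK ?num_real// lerXn2r// nnegrE (le_trans ler01).
  have := sqr_ge0 (Y (k, i) w); have : 1 <= K ^+ 2 by rewrite exprn_ege1.
  by rewrite ler_norml /summand_bound; lra.
split => //.
- move=> k; apply: bounded_measurableB; last exact: bounded_measurable_cst.
  by apply: bounded_measurableX; exact: depends_on_Y.
- by move=> k; rewrite meanB// mean1 mean_cst subrr.
- move=> k; rewrite -[leRHS](mean_cst P); apply: le_mean.
  + exact: bounded_measurableX.
  + exact: bounded_measurable_cst.
  + move=> w; rewrite -[leLHS]real_normK ?num_real// lerXn2r// nnegrE//.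
    by rewrite (le_trans ler01)// summand_bound_ge1.
Qed.

Lemma product_family i j : i != j ->
  centered_row_family P Y summand_bound 1 (fun k w => Y (k, i) w * Y (k, j) w).
Proof.
move=> ij; have kij k : (k, i) != (k, j) :> nat * nat.
  by apply: contra_neq ij => -[].
split.
- by move=> k; apply: bounded_measurableM; exact: depends_on_Y.
- move=> k w; rewrite normrM; apply: (@le_trans _ _ (K * K)); first by rewrite ler_pM.
  by have := K1; rewrite /summand_bound; nra.
- by move=> k; exact: mean_YY.
- by move=> k; rewrite mean_Y2Y2.
Qed.

(** The variance factors as the second moment 1 of the shared column times that of the sum of two
    independent entries, which is 2. *)
Lemma sum_product_family i j l : i != j -> i != l -> j != l ->
  centered_row_family P Y summand_bound 2
    (fun k w => Y (k, i) w * (Y (k, j) w + Y (k, l) w)).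
Proof.
move=> ij il jl; have kne k a b : a != b -> (k, a) != (k, b) :> nat * nat.
  by apply: contra_neq => -[].
have dI (k : nat) : [set (k, i)] `&` [set (k, j); (k, l)] = set0.
  apply/seteqP; split => // x [-> /=] [[E]|[E]]; first by rewrite E eqxx in ij.
  by rewrite E eqxx in il.
have d1 k : depends_on Y [set (k, i)] (Y (k, i)) by exact: depends_on_Y.
have d2 k : depends_on Y [set (k, j); (k, l)] (fun w => Y (k, j) w + Y (k, l) w).
  by apply: bounded_measurableD; apply: depends_on_Y; [left | right].
split.
- move=> k; apply: bounded_measurableM; first exact: depends_on_Y.
  by apply: bounded_measurableD; exact: depends_on_Y.
- move=> k w; rewrite normrM; apply: (@le_trans _ _ (K * (K + K))).
    by rewrite ler_pM// (le_trans (ler_normD _ _))// lerD.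
  by have := K1; rewrite /summand_bound; nra.
- by move=> k; rewrite (mean_prod mY indepY (dI k))// mean0 mul0r.
- move=> k; under eq_mean do rewrite exprMn.
  rewrite (mean_prod mY indepY (dI k)).
  + rewrite mean1 mul1r.
    rewrite (@eq_mean _ _ _ P _ (fun w => Y (k, j) w ^+ 2 + Y (k, l) w ^+ 2 +
      2 * (Y (k, j) w * Y (k, l) w))); last by move=> w; ring.
    have b1 := bounded_measurableX 2 (bY (k, j)).
    have b2 := bounded_measurableX 2 (bY (k, l)).
    have b3 := bounded_measurableM (bY (k, j)) (bY (k, l)).
    rewrite meanD ?meanD ?meanZ ?mean1 ?mean_YY ?kne//; first lra.
      exact: bounded_measurableD.
    exact: bounded_measurableZ.
  + by apply: bounded_measurableX; exact: d1.
  + by apply: bounded_measurableX; exact: d2.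
Qed.

(** The one-sided bound [tail_le] is applied to the family and to its negative. *)
Lemma fails_within_sum (v : R) z n s a b :
  centered_row_family P Y summand_bound v z -> 0 <= s -> 0 <= b -> b * s * cubic_coef <= 1 / 2 ->
  fails_within P (fun w => `|\sum_(k < n) z k w| <= a * (n%:R * s))
    (2 * expR (- (n%:R * s ^+ 2) * (a * b - b ^+ 2 * v / 2 - cubic_coef * b ^+ 3 * s))).
Proof.
move=> zP s0 b0 bsc.
have fail z' : centered_row_family P Y summand_bound v z' ->
    fails_within P (fun w => ~ [set w | a * (n%:R * s) <= \sum_(k < n) z' k w] w)
      (expR (- (n%:R * s ^+ 2) * (a * b - b ^+ 2 * v / 2 - cubic_coef * b ^+ 3 * s))).
  move=> zP'; apply: fails_within_not.
    apply: measurable_ge; apply: bounded_measurable_sum => k.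
    by case: zP' => dz _ _ _; exact: depends_on_measurable (dz k).
  exact: (tail_le mY indepY summand_bound_ge1 zP' n a s0 b0 bsc).
have := fails_within_and (fail _ zP) (fail _ (centered_row_familyN zP)).
apply: fails_withinW; last by lra.
move=> w [/negP + /negP]; rewrite sumrN -!ltNge ler_norml => h1 h2.
by rewrite lerNl !ltW.
Qed.

Definition dotY n i j w : R := col_dot (fun k l => Y (k, l) w) n i j.

Lemma dotYC n i j : dotY n i j = dotY n j i.
Proof. by apply/funext => w; apply: eq_bigr => k _; rewrite mulrC. Qed.

Lemma depends_on_dotY n i j : depends_on Y [set k | k.2 = i \/ k.2 = j] (dotY n i j).
Proof.
apply: bounded_measurable_sum => k.
by apply: bounded_measurableM; apply: depends_on_Y; [left | right].
Qed.

Let bdotY n i j : bounded_measurable (dotY n i j).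
Proof. exact: depends_on_measurable (depends_on_dotY n i j). Qed.

(** If both products are large, their sum exceeds [2 * a * (n%:R * s)]. Its terms have variance 2,
    so the tilt [a] yields the exponent [a ^+ 2], twice the exponent [a ^+ 2 / 2] of a single
    product. *)
Lemma joint_tail_le n (s a : R) (i j l : nat) : i != j -> i != l -> j != l ->
  0 <= s -> 0 <= a -> a * s * cubic_coef <= 1 / 2 ->
  mean P (fun w => \1_[set w | a * (n%:R * s) <= dotY n i j w] w *
                   \1_[set w | a * (n%:R * s) <= dotY n i l w] w) <=
  expR (- (n%:R * s ^+ 2) * (a ^+ 2 - cubic_coef * a ^+ 3 * s)).
Proof.
move=> ij il jl s0 a0 asc.
have zP := sum_product_family ij il jl.
have := tail_le mY indepY summand_bound_ge1 zP n (2 * a) s0 a0 asc.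
rewrite (_ : 2 * a * a - a ^+ 2 * 2 / 2 - cubic_coef * a ^+ 3 * s =
  a ^+ 2 - cubic_coef * a ^+ 3 * s); last by field.
apply: le_trans; apply: le_mean.
- by apply: bounded_measurableM; apply: bounded_measurable_indic; exact: measurable_ge.
- apply/bounded_measurable_indic/measurable_ge/bounded_measurable_sum => k.
  by case: zP => dz _ _ _; exact: depends_on_measurable (dz k).
- move=> w; rewrite !indicE.
  case: (boolP (w \in [set w | a * (n%:R * s) <= dotY n i j w])) => [|_]; last by rewrite mul0r.
  case: (boolP (w \in [set w | a * (n%:R * s) <= dotY n i l w])) => [|_]; last by rewrite mulr0.
  rewrite !inE/= mulr1 => h1 h2; rewrite mem_set//=.
  have -> : \sum_(k < n) Y (nat_of_ord k, i) w *
      (Y (nat_of_ord k, j) w + Y (nat_of_ord k, l) w) = dotY n i j w + dotY n i l w.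
    by rewrite -big_split/=; apply: eq_bigr => k _; rewrite mulrDr.
  by lra.
Qed.

Lemma disjoint_pairs_mean n t i j i' j' : i != i' -> i != j' -> j != i' -> j != j' ->
  mean P (fun w => \1_[set w | t <= dotY n i j w] w * \1_[set w | t <= dotY n i' j' w] w) =
  mean P \1_[set w | t <= dotY n i j w] * mean P \1_[set w | t <= dotY n i' j' w].
Proof.
move=> ii ij ji jj.
have dep a b : depends_on Y [set k | k.2 = a \/ k.2 = b] (\1_[set w | t <= dotY n a b w] : T -> R).
  apply: bounded_measurable_indic; apply: measurable_ge; exact: depends_on_dotY.
rewrite (@mean_prod _ _ _ _ _ Y mY indepY
  [set k | k.2 = i \/ k.2 = j] [set k | k.2 = i' \/ k.2 = j'])//.
by apply/seteqP; split => // -[k l] /= [[->|->] [E|E]];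
  move: ii ij ji jj; rewrite E eqxx.
Qed.

(** * Simultaneous estimates at the scale where [n s^2] is the logarithm of [p] *)

Section scale.
Variables (n p : nat) (s eps : R).
Local Notation L := (n%:R * s ^+ 2).
Hypothesis s_ge0 : 0 <= s.
Hypothesis eps_gt0 : 0 < eps.
Hypothesis eps_le1 : eps <= 1.
Hypothesis p_ge2 : (2 <= p)%N.
Hypothesis pE : p%:R = expR L.
(** All tilts used are at most 3, whence [27 = 3 ^ 3]; the right side is the slack that [tail_ge]
    allows at [eta = eps / 96]. *)
Hypothesis s_small : 27 * cubic_coef * s <= (eps / 96) ^+ 2 / 8.

Let cs27 : 27 * (cubic_coef * s) <= eps / 500.
Proof.
rewrite mulrA; apply: le_trans s_small _.
have h : eps ^+ 2 <= eps by rewrite expr2 ler_piMl// ltW.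
have := eps_gt0; lra.
Qed.

Let cs0 : 0 <= cubic_coef * s.
Proof. by rewrite mulr_ge0// (le_trans ler01)// cubic_coef_ge1. Qed.

Let le3 t : 0 <= t -> t <= 3 ->
  t * s * cubic_coef <= 1 / 2 /\ cubic_coef * t ^+ 3 * s <= 27 * (cubic_coef * s).
Proof.
move=> t0 t3; split.
  have : t * (cubic_coef * s) <= 3 * (cubic_coef * s) by rewrite ler_wpM2r.
  by have := cs27; have := eps_le1; lra.
have : t ^+ 3 * (cubic_coef * s) <= 3 ^+ 3 * (cubic_coef * s).
  by rewrite ler_wpM2r// lerXn2r// nnegrE.
by lra.
Qed.

(** The second moment method at threshold [a = 2 - eps / 2]. About [p ^ 2] pairs, each of
    probability near [p] to the power [- a ^+ 2 / 2 > - 2], give a growing expected count. The ratio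
    [r / q ^+ 2] is at most a constant times a small power of [p], beaten by [1 / m]. *)
Lemma exists_large_dot : expR (- L * ((eps / 96) ^+ 2 / 4)) <= 1 / 4 ->
  fails_within P (fun w => exists i j, [/\ (i < j)%N, (j < p)%N &
    (2 - eps / 2) * (n%:R * s) <= dotY n i j w]) (64 * expR (- L * (eps / 2))).
Proof.
move=> L4; pose m := p./2.
have e0 := eps_gt0; have e1 := eps_le1.
have p2m : (m.*2 <= p)%N by rewrite /m -[leqRHS]odd_double_half leq_addl.
have m0 : (0 < m)%N by rewrite /m; case: p p_ge2 => [//|[]].
(* True for odd [p] too because [p >= 2]; it gives [1 / m <= 4 / p]. *)
have pm4 : (p <= 4 * m)%N.
  rewrite -[leqLHS]odd_double_half -/m -muln2.
  by have : (odd p <= 1)%N by [case: odd]; lia.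
(* This [eta] keeps the exponent [Q] of [tail_ge] within [eps / 16] of [a ^+ 2 / 2]. *)
set a := 2 - eps / 2; pose eta := eps / 96.
have a0 : 0 <= a by rewrite /a; lra.
have a_le3 : a <= 3 by rewrite /a; lra.
have [asc a3] := le3 a0 a_le3.
pose E (e : 'I_m * 'I_m) := [set w | a * (n%:R * s) <= dotY n e.1 (m + e.2)%N w].
pose Q := (a + eta) ^+ 2 / 2 + (a + eta) * eta + eta ^+ 2 / 8.
pose q := expR (- L * Q) / 2.
pose r := expR (- L * (a ^+ 2 - cubic_coef * a ^+ 3 * s)).
(* The second index is shifted by [m], so the two columns of a pair come from disjoint halves and
   never coincide. *)
have mE e : measurable (E e) by exact: measurable_ge.
have neq (i : 'I_m) (j : nat) : (i : nat) != (m + j)%N.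
  by rewrite neq_ltn (leq_trans (ltn_ord i))// leq_addr.
have q_le e : q <= mean P \1_(E e).
  have pf := product_family (neq e.1 e.2).
  have eta0 : 0 <= eta by rewrite /eta; lra.
  have t0 : 0 <= a + 2 * eta by rewrite /a /eta; lra.
  have t3 : a + 2 * eta <= 3 by rewrite /a /eta; lra.
  have [h1 h2] := le3 t0 t3.
  have z1 k : mean P (fun w => (Y (k, nat_of_ord e.1) w * Y (k, (m + e.2)%N) w) ^+ 2) = 1.
    by apply: mean_Y2Y2; apply/negP => /eqP[] /eqP; exact/negP/neq.
  have h3 : (2 * summand_bound ^+ 3 + 1) * (a + 2 * eta) ^+ 3 * s <= eta ^+ 2 / 8.
    by apply: le_trans h2 _; rewrite mulrA.
  exact: (tail_ge mY indepY summand_bound_ge1 pf z1 s_ge0 a0 eta0 h1 h3 L4).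
have := @second_moment _ _ _ P m E q r m0.
have q0 : 0 < q by rewrite divr_gt0// expR_gt0.
move=> /(_ q0 (expR_ge0 _) mE q_le) sm.
have {}sm : mean P \1_[set w | forall e, ~ E e w] <=
    (m%:R ^+ 2 * q)^-1 + 2 * r / (m%:R * q ^+ 2).
  apply: sm.
  - move=> e e' n1 n2; apply: disjoint_pairs_mean.
    + exact: n1.
    + exact: neq.
    + by rewrite eq_sym; exact: neq.
    + by rewrite eqn_add2l.
  - move=> e e' ee; case: (eqVneq e.1 e'.1) => [e11 _|n1 /= /eqP e22].
      have n2 : e.2 != e'.2 by apply: contra_neq ee; case: (e) (e') e11 => ? ? [? ?] /= -> ->.
      rewrite /E -e11; apply: joint_tail_le => //.
      by rewrite eqn_add2l.
    (* When the second column is shared, symmetry of the scalar product moves it to the first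
       place. *)
    rewrite /E -e22 ![dotY n _ (m + e.2)]dotYC; apply: joint_tail_le => //.
      by rewrite eq_sym; exact: neq.
    by rewrite eq_sym; exact: neq.
have mA : measurable [set w | forall e, ~ E e w] by exact: measurable_forall_notin.
have := fails_within_not mA sm; apply: fails_withinW.
  move=> w /= /existsNP[[i j]] /contrapT Ew; exists i, (m + j)%N; split => //.
    by rewrite (leq_trans (ltn_ord i))// leq_addr.
  by rewrite (leq_trans _ p2m)// -addnn ltn_add2l.
have L0 : 0 <= L by rewrite mulr_ge0// sqr_ge0.
have mR : 0 < m%:R :> R by rewrite ltr0n.
have mV : m%:R^-1 <= 4 * expR (- L).
  rewrite expRN -[4]invrK -invfM lef_pV2 ?posrE// ?mulr_gt0 ?invr_gt0 ?expR_gt0//.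
  rewrite ler_pdivrMl// -pE -natrM ler_nat//.
have mV0 : 0 <= m%:R^-1 :> R by rewrite invr_ge0 ltW.
have qV : q^-1 = 2 * expR (L * Q) by rewrite /q invfM invrK -expRN mulNr opprK mulrC.
have Qa : Q <= a ^+ 2 / 2 + eps / 16.
  have : eta ^+ 2 <= eta by rewrite expr2 ler_piMl// /eta; lra.
  have : 0 <= eps * eta by rewrite mulr_ge0// /eta; lra.
  by rewrite /Q /eta /a; lra.
have a2 : a ^+ 2 / 2 <= 2 - 7 * eps / 8.
  have : eps ^+ 2 <= eps by rewrite expr2 ler_piMl// ltW.
  by rewrite /a; lra.
(* The exponent is [2 - Q], at least [7 * eps / 8 - eps / 16], hence at least [eps / 2]. *)
have t1 : (m%:R ^+ 2 * q)^-1 <= 32 * expR (- L * (eps / 2)).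
  rewrite invfM qV -exprVn.
  apply: (@le_trans _ _ ((4 * expR (- L)) ^+ 2 * (2 * expR (L * Q)))).
    rewrite ler_wpM2r//.
    by rewrite lerXn2r// nnegrE// (le_trans mV0).
  rewrite (_ : _ * _ = 32 * expR (- L * (2 - Q))); last first.
    rewrite (_ : - L * (2 - Q) = - L + - L + L * Q); last by ring.
    by rewrite !expRD; ring.
  rewrite ler_pM2l// ler_expR !mulNr lerN2 ler_wpM2l//; lra.
(* Here [a ^+ 2] cancels against [2 * Q] up to [eps / 8]; the 1 coming from [1 / m] outweighs this
   and the cubic error. *)
have t2 : 2 * r / (m%:R * q ^+ 2) <= 32 * expR (- L * (eps / 2)).
  rewrite invfM -exprVn qV.
  apply: (@le_trans _ _ (2 * r * ((4 * expR (- L)) * (2 * expR (L * Q)) ^+ 2))).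
    have r0 : 0 <= 2 * r by rewrite mulr_ge0// expR_ge0.
    by rewrite (ler_wpM2l r0)// ler_wpM2r// sqr_ge0.
  rewrite (_ : _ * _ =
      32 * expR (- L * (1 + (a ^+ 2 - cubic_coef * a ^+ 3 * s) - 2 * Q))); last first.
    rewrite (_ : - L * (1 + (a ^+ 2 - cubic_coef * a ^+ 3 * s) - 2 * Q) =
      - L * (a ^+ 2 - cubic_coef * a ^+ 3 * s) + - L + (L * Q + L * Q)); last by ring.
    by rewrite !expRD -/r; ring.
  rewrite ler_pM2l// ler_expR !mulNr lerN2 ler_wpM2l//.
  by have := cs27; lra.
by lra.
Qed.

(* Makes the exponent in [fails_within_sum], at [b = 1], beat a union bound over
   the [p = expR L] columns. *)
Definition deviation_coef := summand_bound ^+ 2 / 2 + 3.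

(** Union bounds: [p] columns against tails of order [p ^ -2], and [p ^ 2] pairs against tails of
    order [p] to the power [- (2 + eps / 2)]. The constant 70 is [2 + 2 + 2 + 64]. *)
Lemma all_controlled : expR (- L * ((eps / 96) ^+ 2 / 4)) <= 1 / 4 ->
  fails_within P (fun w => [/\
    forall i, (i < p)%N -> `|col_sum (fun k l => Y (k, l) w) n i| <= deviation_coef * (n%:R * s),
    forall i, (i < p)%N -> `|dotY n i i w - n%:R| <= deviation_coef * (n%:R * s),
    forall i j, (i < j)%N -> (j < p)%N -> `|dotY n i j w| <= (2 + eps / 2) * (n%:R * s) &
    exists i j, [/\ (i < j)%N, (j < p)%N &
      (2 - eps / 2) * (n%:R * s) <= dotY n i j w]])
    (70 * expR (- L * (eps / 2))).
Proof.
move=> L4; have e0 := eps_gt0; have e1 := eps_le1; have cs := cs27.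
have L0 : 0 <= L by rewrite mulr_ge0// sqr_ge0.
have B2 : 1 <= summand_bound ^+ 2 by rewrite exprn_ege1// summand_bound_ge1.
have pe : p%:R * (2 * expR (- L * 2)) = 2 * expR (- L) :> R.
  rewrite pE mulrCA -expRD; congr (_ * expR _); ring.
have eL : expR (- L) <= expR (- L * (eps / 2)).
  by rewrite ler_expR !mulNr lerN2 ler_piMr//; lra.
have one3 : 1 <= 3 :> R by lra.
have [s1 s3] := le3 ler01 one3.
have F1 : fails_within P (fun w => forall i : 'I_p,
    `|\sum_(k < n) Y (nat_of_ord k, nat_of_ord i) w| <=
      deviation_coef * (n%:R * s)) (2 * expR (- L)).
  rewrite -pe (_ : p%:R = #|'I_p|%:R :> R); last by rewrite card_ord.
  apply: fails_within_forall => i.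
  have := fails_within_sum n deviation_coef (entry_family i) s_ge0 ler01 s1.
  apply: fails_withinW => //; rewrite ler_pM2l// ler_expR !mulNr lerN2 ler_wpM2l//.
  by rewrite /deviation_coef; move: s3; rewrite expr1n; lra.
have F2 : fails_within P (fun w => forall i : 'I_p,
    `|\sum_(k < n) (Y (nat_of_ord k, nat_of_ord i) w ^+ 2 - 1)| <=
      deviation_coef * (n%:R * s)) (2 * expR (- L)).
  rewrite -pe (_ : p%:R = #|'I_p|%:R :> R); last by rewrite card_ord.
  apply: fails_within_forall => i.
  have := fails_within_sum n deviation_coef (square_family i) s_ge0 ler01 s1.
  apply: fails_withinW => //; rewrite ler_pM2l// ler_expR !mulNr lerN2 ler_wpM2l//.
  by rewrite /deviation_coef; move: s3; rewrite expr1n; lra.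
pose b := 2 + eps / 2.
have b0 : 0 <= b by rewrite /b; lra.
have b_le3 : b <= 3 by rewrite /b; lra.
have [b1 b3] := le3 b0 b_le3.
have F3 : fails_within P (fun w => forall e : 'I_p * 'I_p, (e.1 < e.2)%N ->
    `|dotY n e.1 e.2 w| <= b * (n%:R * s)) (2 * expR (- L * (eps / 2))).
  have -> : 2 * expR (- L * (eps / 2)) =
      #|{: 'I_p * 'I_p}|%:R * (2 * expR (- L * (2 + eps / 2))).
    rewrite card_prod card_ord natrM pE.
    rewrite (_ : - L * (2 + eps / 2) = - L + - L + - L * (eps / 2)); last by ring.
    by rewrite !expRD expRN; field; rewrite expR_eq0.
  apply: fails_within_forall => e.
  (* Index pairs that are not increasing satisfy the claim vacuously, with the zero function as
     dominating function. *)
  have [e12|e21] := ltnP e.1 e.2; last first.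
    exists (fun=> 0); split => //; first exact: bounded_measurable_cst.
      by move=> w [].
    by rewrite mean_cst mulr_ge0// expR_ge0.
  have pf := product_family (negbT (ltn_eqF e12)).
  have := fails_within_sum n b pf s_ge0 b0 b1.
  apply: fails_withinW => // ; rewrite ler_pM2l// ler_expR !mulNr lerN2 ler_wpM2l//.
  by have : 0 <= eps ^+ 2 by [rewrite sqr_ge0]; rewrite /b in b3 *; lra.
have := fails_within_and (fails_within_and F1 F2) (fails_within_and F3 (exists_large_dot L4)).
apply: fails_withinW; last by lra.
move=> w [[h1 h2] [h3 h4]]; split => //.
- by move=> i ip; exact: (h1 (Ordinal ip)).
- move=> i ip.
  have -> : dotY n i i w - n%:R = \sum_(k < n) (Y (nat_of_ord k, i) w ^+ 2 - 1).
    rewrite sumrB sumr_const card_ord /dotY /col_dot; congr (_ - _).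
  exact: (h2 (Ordinal ip)).
- by move=> i j ij jp; exact: (h3 (Ordinal (ltn_trans ij jp), Ordinal jp)).
Qed.

End scale.

End standardized_array.

(** * Reduction to a bounded standardized array *)

Section measurability.
Context d (T : measurableType d) (R : realType).

(** Inversion is continuous off 0 only, so the line is split into [[set 0]] and its complement. *)
Lemma measurable_invr : measurable_fun setT (@GRing.inv R).
Proof.
rewrite -(setUv [set 0 : R]); apply/measurable_funU.
- exact: measurable_set1.
- by apply: measurableC; exact: measurable_set1.
split.
- exact: measurable_fun_set1.
- apply: open_continuous_measurable_fun.
    by apply: closed_openC; exact: closed_eq.
  move=> x; rewrite inE/= => /eqP x0; exact: inv_continuous.
Qed.

Lemma measurable_lt_norm (f : T -> R) (a : R) : measurable_fun setT f ->
  measurable [set w | a < `|f w|].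
Proof.
move=> mf; rewrite (_ : [set w | _] = ~` [set w | `|f w| <= a]).
  apply: measurableC; rewrite -[X in measurable X]setTI.
  by apply: measurable_fun_le => //; exact: measurableT_comp.
by apply/seteqP; split => w /=; rewrite ltNge => /negP.
Qed.

Lemma measurable_fun_bigmax (I : Type) (s : seq I) (Q : pred I) (F : I -> T -> R) :
  (forall i, measurable_fun setT (F i)) ->
  measurable_fun setT (fun w => \big[Num.max/0]_(i <- s | Q i) F i w).
Proof.
move=> mF; elim: s => [|i s IHs].
  by under eq_fun do rewrite big_nil; exact: measurable_cst.
under eq_fun do rewrite big_cons; case: (Q i) => //.
exact: measurable_maxr.
Qed.

Lemma measurable_coherence n p (x : nat -> nat -> T -> R) :
  (forall i j, measurable_fun setT (x i j)) ->
  measurable_fun setT (fun w =>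
    coherence (\matrix_(i < n, j < p) x (nat_of_ord i) (nat_of_ord j) w)).
Proof.
move=> mx; apply: measurable_fun_bigmax => -[i j].
apply: measurableT_comp => //=.
have mc (l : 'I_p) (k : 'I_n) : measurable_fun setT (fun w =>
    centered (col l (\matrix_(i < n, j < p) x (nat_of_ord i) (nat_of_ord j) w)) k 0).
  rewrite /centered /sample_mean; under eq_fun do rewrite !mxE.
  apply: measurable_funB => //; apply: measurable_funM => //.
  by apply: measurable_sum => m; under eq_fun do rewrite !mxE; exact: mx.
have mn (l : 'I_p) : measurable_fun setT (fun w => euclidean_norm
    (centered (col l (\matrix_(i < n, j < p) x (nat_of_ord i) (nat_of_ord j) w)))).
  apply: measurableT_comp.
    by apply: continuous_measurable_fun; exact: sqrt_continuous.
  by apply: measurable_sum => k; under eq_fun do rewrite expr2; exact: measurable_funM.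
rewrite /sample_correlation; under eq_fun do rewrite mxE mxE.
apply: measurable_funM.
  apply: measurable_sum => k; under eq_fun do rewrite mxE.
  exact: measurable_funM.
apply: (measurableT_comp measurable_invr); exact: measurable_funM.
Qed.

End measurability.

(** * Clipping and standardizing the entries *)

Section standardization.
Context d (T : measurableType d) (R : realType) (P : probability T R).
Context (x : nat * nat -> {RV P >-> R}) (mu sigma C : R).
Hypothesis x_iid : iid x.
Hypothesis x_mean : forall k, ('E_P[x k] = mu%:E)%E.
Hypothesis x_var : forall k, ('V_P[x k] = (sigma ^+ 2)%:E)%E.
Hypothesis sigma2_gt0 : 0 < sigma ^+ 2.
Hypothesis C_gt0 : 0 < C.
Hypothesis x_bounded : {ae P, forall w, `|x (0%N, 0%N) w| <= C}.

(** The entries are bounded only almost surely; clipping makes the bound hold everywhere, as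
    [bounded_measurable] demands, and changes each entry on a null set only. *)
Definition clip (t : R) := Num.max (- C) (Num.min C t).

Definition standardize k w := (clip (x k w) - mu) / sigma.

Definition exceptional : set T :=
  \bigcup_i \bigcup_j [set w | C < `|x (i, j) w|].

Let sigma0 : sigma != 0.
Proof. by apply: contraTneq sigma2_gt0 => ->; rewrite expr0n ltxx. Qed.

Let measurable_large k : measurable [set w | C < `|x k w|].
Proof. exact: measurable_lt_norm. Qed.

Lemma measurable_exceptional : measurable exceptional.
Proof. by apply: bigcupT_measurable => i; apply: bigcupT_measurable => j. Qed.

(** The bound is assumed for one entry; equality of laws on a Borel set carries it to all others. *)
Let large0 k : P [set w | C < `|x k w|] = 0%E.
Proof.
have mA : measurable [set t : R | C < `|t|].
  by apply: (@measurable_lt_norm _ _ _ id); exact: measurable_id.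
have -> : P [set w | C < `|x k w|] = distribution P (x k) [set t : R | C < `|t|] by [].
rewrite (x_iid.2 k (0%N, 0%N))//.
have -> : distribution P (x (0%N, 0%N)) [set t : R | C < `|t|] =
  P [set w | C < `|x (0%N, 0%N) w|] by [].
apply: measure_negligible; first exact: measurable_large.
apply: negligibleS x_bounded => w /= Cx; apply/negP; rewrite -ltNge.
exact: Cx.
Qed.

Lemma exceptional0 : P exceptional = 0%E.
Proof.
apply: measure_negligible; first exact: measurable_exceptional.
apply: negligible_bigcup => i; apply: negligible_bigcup => j.
by apply/negligibleP => //; exact: large0.
Qed.

Let clipE t : `|t| <= C -> clip t = t.
Proof.
rewrite ler_norml => /andP[h1 h2].
by rewrite /clip (min_idPr h2) (max_idPr h1).
Qed.

Let clip_le t : `|clip t| <= C.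
Proof.
rewrite ler_norml /clip le_max lexx/= ge_max; apply/andP; split.
  by have := C_gt0; lra.
by rewrite ge_min lexx.
Qed.

Lemma not_exceptional w k : ~ exceptional w -> x k w = mu + sigma * standardize k w.
Proof.
move=> Nw; rewrite /standardize clipE; first by field.
rewrite leNgt; apply/negP => Cx; apply: Nw; case: k Cx => i j Cx.
by exists i => //; exists j.
Qed.

Let mclip : measurable_fun setT clip.
Proof.
by apply: measurable_maxr => //; apply: measurable_minr.
Qed.

Let bclip k : bounded_measurable (fun w => clip (x k w)).
Proof. by split; [exact: measurableT_comp | exists C]. Qed.

Let ae_clip k : {ae P, forall w, x k w = clip (x k w)}.
Proof.
exists [set w | C < `|x k w|]; split; [exact: measurable_large | exact: large0 |].
move=> w /= xw; rewrite ltNge; apply/negP => /clipE h; apply: xw.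
by rewrite h.
Qed.

Lemma measurable_standardize k : measurable_fun setT (standardize k).
Proof. by apply: measurable_funM => //; apply: measurable_funB => //; case: (bclip k). Qed.

Lemma standardize_indep (F : {fset nat * nat}) (B : nat * nat -> set R) :
  (forall k, k \in F -> measurable (B k)) ->
  P (\bigcap_(k in [set` F]) (standardize k @^-1` B k)) =
  (\prod_(k <- F) P (standardize k @^-1` B k))%E.
Proof.
move=> mB; pose f t := (clip t - mu) / sigma.
have mf : measurable_fun setT f.
  by apply: measurable_funM => //; exact: measurable_funB.
apply: (x_iid.1 F (fun k => f @^-1` B k)) => k kF.
by rewrite -[X in measurable X]setTI; apply: mf => //; exact: mB.
Qed.

(** The added 1 makes this constant at least 1, as required of [K]. *)
Definition standardize_bound := (C + `|mu|) / `|sigma| + 1.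

Lemma standardize_bound_ge1 : 1 <= standardize_bound.
Proof. by rewrite lerDr divr_ge0// addr_ge0// ltW. Qed.

Lemma standardize_le k w : `|standardize k w| <= standardize_bound.
Proof.
rewrite /standardize normrM normfV ler_wpDr// ler_pM2r ?invr_gt0 ?normr_gt0//.
by rewrite (le_trans (ler_normB _ _))// lerD2r.
Qed.

(** Clipping does not change the integral, as it acts on a null set; the same holds for the second
    moment below. *)
Lemma mean_standardize k : mean P (standardize k) = 0.
Proof.
have mclipE : mean P (fun w => clip (x k w)) = mu.
  apply: EFin_inj; rewrite -(x_mean k) unlock /mean /Rintegral fineK; last first.
    exact/integrable_fin_num/bounded_measurable_integrable.
  apply: ae_eq_integral => //.
  - by apply/measurable_EFinP; case: (bclip k).
  - exact/measurable_EFinP.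
  - by apply: filterS (ae_clip k) => w /= h _; rewrite -h.
have bc := @bounded_measurable_cst _ T R mu.
rewrite (@eq_mean _ _ _ P _ (fun w => sigma^-1 * (clip (x k w) - mu))); last first.
  by move=> w; rewrite mulrC.
rewrite meanZ; last exact: bounded_measurableB.
by rewrite meanB// mclipE mean_cst subrr mulr0.
Qed.

Lemma mean_standardize2 k : mean P (fun w => standardize k w ^+ 2) = 1.
Proof.
have bc := @bounded_measurable_cst _ T R mu.
have bs : bounded_measurable (fun w => (clip (x k w) - mu) ^+ 2).
  by apply: bounded_measurableX; exact: bounded_measurableB.
have vE : mean P (fun w => (clip (x k w) - mu) ^+ 2) = sigma ^+ 2.
  apply: EFin_inj; rewrite -(x_var k) /variance unlock x_mean/= unlock.
  rewrite /mean /Rintegral fineK; last first.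
    exact: (integrable_fin_num _ (bounded_measurable_integrable P bs)).
  apply: ae_eq_integral => //.
  - by apply/measurable_EFinP; case: bs.
  - apply/measurable_EFinP; apply: measurable_funM; exact: measurable_funB.
  - by apply: filterS (ae_clip k) => w /= h _; rewrite -h expr2.
rewrite (@eq_mean _ _ _ P _ (fun w => (sigma ^+ 2)^-1 * (clip (x k w) - mu) ^+ 2)); last first.
  by move=> w; rewrite /standardize; field.
by rewrite meanZ// vE mulVf// expf_neq0.
Qed.

End standardization.

(** * Eventual bounds from the growth conditions on [p] *)

Section asymptotics.
Context (R : realType) (p : nat -> nat).
Hypothesis p_cvg : p n @[n --> \oo] --> \oo.

Lemma near_ln_ge (M : R) : \forall n \near \oo, M <= ln (p n)%:R.
Proof.
have [k kM] : exists k : nat, expR M <= k%:R.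
  by exists (Num.bound (expR M)); rewrite ltW// archi_boundP// expR_ge0.
have kp : \forall n \near \oo, (k < p n)%N.
  exact: (@p_cvg [set m | (k < m)%N] (nbhs_infty_gt k)).
apply: filterS kp => n /= kp.
have p0 : 0 < (p n)%:R :> R by rewrite ltr0n (leq_ltn_trans _ kp).
by rewrite -ler_expR lnK ?posrE// (le_trans kM)// ler_nat ltnW.
Qed.

Lemma near_expR_ln_le (a e : R) : 0 < a -> 0 < e ->
  \forall n \near \oo, expR (- ln (p n)%:R * a) <= e.
Proof.
move=> a0 e0; apply: filterS (near_ln_ge (e^-1 / a)) => n Mn.
have h : e^-1 <= ln (p n)%:R * a by rewrite -ler_pdivrMr.
rewrite mulNr expRN -[leRHS]invrK lef_pV2 ?posrE ?expR_gt0 ?invr_gt0//.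
by apply: le_trans h _; apply: le_trans (expR_ge1Dx _); rewrite lerDr.
Qed.

Hypothesis log_p : (fun n => ln (p n)%:R : R) =o_\oo (fun n => n%:R : R).

(** The little-o hypothesis is used with constant [e ^+ 2], before taking the square root. *)
Lemma near_scale_le (e : R) : 0 < e ->
  \forall n \near \oo, Num.sqrt (ln (p n)%:R / n%:R) <= e.
Proof.
move=> e0; have e20 : 0 < e ^+ 2 by rewrite exprn_gt0.
have /eqoP/(_ _ e20) := log_p; apply: filterS2 (nbhs_infty_gt 0) => n n0 /=.
have nR : 0 < n%:R :> R by rewrite ltr0n.
rewrite (ger0_norm (ltW nR)) => /(le_trans (ler_norm _)) h.
rewrite -[leRHS](ger0_norm (ltW e0)) -sqrtr_sqr ler_wsqrtr//.
by rewrite ler_pdivrMr.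
Qed.

End asymptotics.

(** * Convergence in probability of the scaled coherence *)

Theorem theorem1 (R : realType) (d : measure_display) (T : measurableType d)
  (P : probability T R) (x : nat * nat -> {RV P >-> R})
  (mu sigma C : R) (p : nat -> nat)
  (x_iid : iid x)
  (x_mean : forall k, ('E_P[x k] = mu%:E)%E)
  (x_var : forall k, ('V_P[x k] = (sigma ^+ 2)%:E)%E)
  (sigma2_gt0 : 0 < sigma ^+ 2)
  (C_gt0 : 0 < C)
  (x_bounded : {ae P, forall w, `|x (0%N, 0%N) w| <= C})
  (p_gt0 : forall n, (0 < n)%N -> (0 < p n)%N)
  (p_cvg : p n @[n --> \oo] --> \oo)
  (log_p : (fun n => ln (p n)%:R : R) =o_\oo (fun n => n%:R : R)) :
  cvg_in_probability P
    (fun n w => Num.sqrt (n%:R / ln (p n)%:R) *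
       coherence (\matrix_(i < n, j < p n) x (nat_of_ord i, nat_of_ord j) w))
    2.
Proof.
move=> eps0 eps0_gt0.
(* The estimates need [eps <= 1]; a smaller tolerance only strengthens the conclusion. *)
pose eps := Num.min eps0 1.
have eps_gt0 : 0 < eps by rewrite lt_min eps0_gt0 ltr01.
have eps_le1 : eps <= 1 by rewrite ge_min lexx orbT.
have sigma0 : sigma != 0 by apply: contraTneq sigma2_gt0 => ->; rewrite expr0n ltxx.
pose Y := standardize x mu sigma C.
pose K := standardize_bound mu sigma C.
have mY k : measurable_fun setT (Y k) by exact: measurable_standardize.
have indepY := @standardize_indep _ _ _ P x mu sigma C x_iid.
have K1 : 1 <= K by exact: standardize_bound_ge1.
have YK k w : `|Y k w| <= K by exact: standardize_le.
have Y0 k : mean P (Y k) = 0 by exact: mean_standardize.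
have Y1 k : mean P (fun w => Y k w ^+ 2) = 1 by exact: mean_standardize2.
pose Z n w := Num.sqrt (n%:R / ln (p n)%:R) *
  coherence (\matrix_(i < n, j < p n) x (nat_of_ord i, nat_of_ord j) w).
pose E n := [set w | eps0 <= `|Z n w - 2|].
have mE n : measurable (E n).
  rewrite -[X in measurable X]setTI; apply: measurable_fun_le => //.
  apply: measurableT_comp => //; apply: measurable_funB => //.
  apply: measurable_funM => //.
  exact: (@measurable_coherence _ _ _ n (p n) (fun i j => x (i, j))).
pose N := exceptional x C.
have mN : measurable N by exact: measurable_exceptional.
have N0 : P N = 0%E by exact: exceptional0.
have c0 : 0 < cubic_coef K by rewrite (lt_le_trans ltr01)// cubic_coef_ge1.
have A0 : 0 < deviation_coef K by rewrite /deviation_coef ltr_wpDl// divr_ge0// sqr_ge0.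
have main : \forall n \near \oo, mean P \1_(E n) <= 70 * expR (- ln (p n)%:R * (eps / 2)).
  have eta0 : 0 < eps / 96 by rewrite divr_gt0.
  have eta2 : 0 < (eps / 96) ^+ 2 / 8 by rewrite divr_gt0// exprn_gt0.
  have a0 : 0 < 4 * deviation_coef K ^+ 2 + 3 * deviation_coef K.
    by rewrite addr_gt0// mulr_gt0// exprn_gt0.
  (* [s <= t1] will give the condition [s_small], and [s <= t2] the one of [coherence_near2];
     [eps / 4] in [t2] makes the latter strict. *)
  pose t1 := (eps / 96) ^+ 2 / 8 / (27 * cubic_coef K).
  pose t2 := eps / 4 / (4 * deviation_coef K ^+ 2 + 3 * deviation_coef K).
  have t10 : 0 < t1 by rewrite divr_gt0// mulr_gt0.
  have t20 : 0 < t2 by rewrite !divr_gt0.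
  near=> n.
  have n0 : (0 < n)%N by near: n; exact: nbhs_infty_gt.
  have nR : 0 < n%:R :> R by rewrite ltr0n.
  have p2 : (2 <= p n)%N by near: n; exact: (@p_cvg [set m | (2 <= m)%N] (nbhs_infty_ge 2)).
  have pR : 0 < (p n)%:R :> R by rewrite ltr0n (leq_trans _ p2).
  have L0 : 0 < ln (p n)%:R :> R by rewrite ln_gt0// ltr1n.
  pose s : R := Num.sqrt (ln (p n)%:R / n%:R).
  have s0 : 0 < s by rewrite sqrtr_gt0 divr_gt0.
  have LE : n%:R * s ^+ 2 = ln (p n)%:R.
    by rewrite sqr_sqrtr ?divr_ge0// ?ltW//; field; rewrite gt_eqF.
  have pE : (p n)%:R = expR (n%:R * s ^+ 2) by rewrite LE lnK.
  have s1 : s <= 1 by rewrite /s; near: n; apply: near_scale_le.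
  have st1 : s <= t1 by rewrite /s; near: n; apply: near_scale_le.
  have st2 : s <= t2 by rewrite /s; near: n; apply: near_scale_le.
  have L4 : expR (- (n%:R * s ^+ 2) * ((eps / 96) ^+ 2 / 4)) <= 1 / 4.
    by rewrite LE; near: n; apply: near_expR_ln_le => //; rewrite divr_gt0// exprn_gt0.
  have s_small : 27 * cubic_coef K * s <= (eps / 96) ^+ 2 / 8.
    by rewrite mulrC -ler_pdivlMr// mulr_gt0.
  have sA : s * (4 * deviation_coef K ^+ 2 + 3 * deviation_coef K) < eps / 2.
    apply: (@le_lt_trans _ _ (eps / 4)); first by rewrite -ler_pdivlMr.
    by have := eps_gt0; lra.
  have [g [bg g0 gE gle]] := all_controlled mY indepY K1 YK Y0 Y1 (ltW s0) eps_gt0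
    eps_le1 p2 pE s_small L4.
  have bN := @bounded_measurable_indic _ T R _ mN.
  have NE : mean P \1_N = 0 by rewrite mean_indic// N0.
  (* The null set [N], where data and standardized array may disagree, is covered by its own
     indicator at no cost; off [N] the deterministic lemma forces [g w >= 1] on [E n]. *)
  rewrite -LE -[leRHS]addr0 -NE; apply: (@le_trans _ _ (mean P (fun w => g w + \1_N w))).
    apply: le_mean; [exact: bounded_measurable_indic | exact: bounded_measurableD |].
    move=> w; rewrite indicE; case: (boolP (w \in E n)) => [|_]; last first.
      by rewrite addr_ge0// indicE.
    rewrite inE/= => Ew; rewrite [X in _ + X]indicE.
    have [Nw|Nw] := boolP (w \in N); first by rewrite ler_wpDl.
    rewrite addr0; apply: gE => -[h1 h2 h3 h4].
    have xE k l : (k < n)%N -> (l < p n)%N -> x (k, l) w = mu + sigma * Y (k, l) w.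
      by move=> _ _; apply: not_exceptional => //; move: Nw; rewrite notin_setE.
    have := coherence_near2 n0 sigma0 xE s0 s1 (ltW A0) eps_le1 sA h1 h2 h3 h4.
    have -> : s^-1 = Num.sqrt (n%:R / ln (p n)%:R) by rewrite /s -sqrtrV ?invf_div// ltW// divr_gt0.
    rewrite ltNge => /negP; apply; apply: le_trans Ew.
    by rewrite ge_min lexx.
  by rewrite meanD// lerD2r.
have fE n : P (E n) = (mean P \1_(E n))%:E.
  by rewrite mean_indic// fineK// fin_num_measure.
rewrite (_ : (fun n => P [set w | eps0 <= `|_|]) = fun n => (mean P \1_(E n))%:E); last first.
  by apply/funext => n; rewrite -fE.
apply: cvg_EFin; first by near=> n.
apply/cvgr0Pnorm_le => e e0 /=.
have e70 : 0 < e / 70 by rewrite divr_gt0.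
have eps2 : 0 < eps / 2 by rewrite divr_gt0.
apply: filterS2 main (near_expR_ln_le p_cvg eps2 e70) => n h1 h2.
rewrite ger0_norm; last by rewrite mean_indic// fine_ge0.
by apply: le_trans h1 _; lra.
Unshelve. all: by end_near. Qed.
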